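(* Let $f:\mathbb{R}^d\to[0,\infty)$ be an upper semi-continuous log-concave function with finite positive integral, and let $\overline{K}=\{(x,\xi)\in\mathbb{R}^{d+1} : x\in\mathbb{R}^d,\ |\xi|\le f(x)/2\}$ be its symmetrized subgraph. Assume that the Euclidean unit ball $\mathbf{B}^{d+1}$ of $\mathbb{R}^{d+1}$ is contained in $\overline{K}$. Then the following are equivalent. (1) The ball $\mathbf{B}^{d+1}$ is the unique maximum volume ellipsoid contained in $\overline{K}$. (2) There are contact points $\overline{u}_1,\ldots,\overline{u}_k\in \mathrm{bd}(\mathbf{B}^{d+1})\cap \mathrm{bd}(\overline{K})$ and positive weights $c_1,\ldots,c_k$ such that $$\sum_{i=1}^k c_i\,\overline{u}_i\otimes\overline{u}_i=\overline{I}\quad\text{and}\quad \sum_{i=1}^k c_i u_i=0,$$ where $u_i$ is the orthogonal projection of $\overline{u}_i$ onto $\mathbb{R}^d$ and $\overline{I}$ is the $(d+1)\times(d+1)$ identity matrix.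
   Context: A function $f:\mathbb{R}^d\to[0,\infty)$ is log-concave if $f=e^{-\psi}$ for some convex $\psi:\mathbb{R}^d\to\mathbb{R}\cup\{\infty\}$ (with $e^{-\infty}=0$). $\mathbb{R}^d$ is identified with the hyperplane of $\mathbb{R}^{d+1}$ spanned by the first $d$ standard basis vectors. $\mathrm{bd}$ denotes the topological boundary in $\mathbb{R}^{d+1}$, and $u\otimes u$ denotes the rank-one matrix $uu^{\intercal}$. *)

(* Defs.v *)
From HB Require Import structures.
From mathcomp Require Import all_boot all_order all_algebra.
From mathcomp Require Import all_classical all_reals all_analysis.

Set Implicit Arguments.
Unset Strict Implicit.
Unset Printing Implicit Defensive.

Import Order.TTheory GRing.Theory Num.Theory.
Import numFieldNormedType.Exports.

Local Open Scope classical_set_scope.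
Local Open Scope ring_scope.

(* The library has Lebesgue measure on R only.  On n-tuples, with their product
   sigma-algebra, we define it as the n-fold product of Lebesgue measure on R;
   for n = 0 it is the unit mass at the empty tuple. *)
Section lebesgue_tuple.
Context {R : realType}.
Let T := measurableTypeR R.

Definition tuple_of_pair n (p : T * n.-tuple T) : n.+1.-tuple T :=
  [the n.+1.-tuple T of p.1 :: p.2].

Lemma measurable_tuple_of_pair n :
  measurable_fun [set: T * n.-tuple T] (@tuple_of_pair n).
Proof. exact: measurable_cons. Qed.

Section successor.
Variables (n : nat) (mu : {sigma_finite_measure set (n.-tuple T) -> \bar R}).

Definition lebesgue_cons : set (n.+1.-tuple T) -> \bar R :=
  pushforward (@lebesgue_measure R \x mu)%E (@tuple_of_pair n).

Let lebesgue_cons0 : lebesgue_cons set0 = 0%E.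
Proof. by rewrite /lebesgue_cons /pushforward preimage_set0 measure0. Qed.

Let lebesgue_cons_ge0 A : (0 <= lebesgue_cons A)%E.
Proof. by rewrite /lebesgue_cons /pushforward measure_ge0. Qed.

Let lebesgue_cons_sigma_additive : semi_sigma_additive lebesgue_cons.
Proof.
have mpre A : measurable A -> measurable (@tuple_of_pair n @^-1` A).
  by move=> mA; rewrite -[X in measurable X]setTI;
     exact: measurable_tuple_of_pair.
move=> F mF tF mUF; rewrite /lebesgue_cons /pushforward preimage_bigcup.
apply: measure_semi_sigma_additive => [k||].
- exact: mpre.
- apply/trivIsetP => i j _ _ ij; rewrite -preimage_setI.
  by move/trivIsetP : tF => /(_ i j Logic.I Logic.I ij) ->; exact: preimage_set0.
- by rewrite -preimage_bigcup; exact: mpre.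
Qed.

HB.instance Definition _ := isMeasure.Build _ _ _ lebesgue_cons
  lebesgue_cons0 lebesgue_cons_ge0 lebesgue_cons_sigma_additive.

Let lebesgue_cons_sigma_finite : sigma_finite setT lebesgue_cons.
Proof.
have /sigma_finiteP[F [TF ndF Foo]] := sigma_finiteT (@lebesgue_measure R).
have /sigma_finiteP[G [TG ndG Goo]] := sigma_finiteT mu.
pose uncons (t : n.+1.-tuple T) : T * n.-tuple T :=
  (thead t, [tuple of behead t]).
have consK : cancel (@tuple_of_pair n) uncons.
  by move=> [x t]; rewrite /uncons theadE; congr pair; exact/val_inj.
have muncons : measurable_fun [set: n.+1.-tuple T] uncons.
  apply/measurable_fun_pair; first exact: measurable_tnth.
  exact: measurable_behead.
exists (fun k => uncons @^-1` (F k `*` G k)).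
  rewrite -preimage_bigcup -(preimage_setT uncons); congr (_ @^-1` _).
  rewrite -setXTT TF TG predeqE => -[x y]; split.
    move=> [/= [k _ Fkx] [l _ Gly]]; exists (maxn k l) => //; split.
    - by move: x Fkx; exact/subsetPset/ndF/leq_maxl.
    - by move: y Gly; exact/subsetPset/ndG/leq_maxr.
  by move=> [k _ []/= ? ?]; split; exists k.
move=> k; have [mF Fk] := Foo k; have [mG Gk] := Goo k; split.
  by rewrite -[X in measurable X]setTI; apply: muncons => //; exact: measurableX.
rewrite /lebesgue_cons /pushforward -comp_preimage.
have -> : uncons \o @tuple_of_pair n = id by apply/funext => p; exact: consK.
rewrite preimage_id (product_measure1E (@lebesgue_measure R) mu)//.
by rewrite lte_mul_pinfty// ge0_fin_numE.
Qed.

HB.instance Definition _ := Measure_isSigmaFinite.Build _ _ _ lebesgue_cons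
  lebesgue_cons_sigma_finite.

End successor.

Fixpoint lebesgue_tuple n : {sigma_finite_measure set (n.-tuple T) -> \bar R} :=
  match n with
  | 0 => \d_([tuple] : 0.-tuple T)
  | m.+1 => lebesgue_cons (lebesgue_tuple m)
  end.

Lemma lebesgue_tuple_box n (A : 'I_n -> set T) :
  (forall i, measurable (A i)) ->
  measurable [set t : n.-tuple T | forall i, A i (tnth t i)] /\
  lebesgue_tuple n [set t | forall i, A i (tnth t i)] =
    (\prod_(i < n) lebesgue_measure (A i))%E.
Proof.
elim: n A => [|n IH] A mA.
  rewrite big_ord0 (_ : [set _ | _] = setT).
    by split => //=; rewrite diracT.
  by apply/seteqP; split => // t _ [].
have [mB vB] := IH (fun i => A (lift ord0 i)) (fun i => mA _).
split.
  rewrite (_ : [set _ | _] = \bigcap_(i in [set: 'I_n.+1])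
      ((fun t : n.+1.-tuple T => tnth t i) @^-1` A i)).
    apply: fin_bigcap_measurable => // i _.
    by rewrite -[X in measurable X]setTI; exact: measurable_tnth.
  by apply/seteqP; split=> t /= h i; [move=> _; exact: h|exact: (h i Logic.I)].
rewrite big_ord_recl -vB /= /lebesgue_cons /pushforward.
rewrite -(product_measure1E lebesgue_measure (lebesgue_tuple n))//.
congr ((_ \x _)%E _); apply/seteqP; split => -[x t] /=.
  move=> h; split => [|i]; first by have := h ord0.
  by have := h (lift ord0 i); rewrite tnthS.
by move=> [h0 h] i; case: (unliftP ord0 i) => [j|] ->; rewrite ?tnthS//; exact: h.
Qed.

End lebesgue_tuple.

Section euclidean_space.
Context {R : realType} {n : nat}.
Implicit Types (x y v : 'rV[R]_n) (A K E : set 'rV[R]_n).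

Definition row_of_tuple (t : n.-tuple (measurableTypeR R)) : 'rV[R]_n :=
  \row_i tnth t i.

Definition volume A : \bar R := lebesgue_tuple n (row_of_tuple @^-1` A).

Definition lebesgue_integral_rV (f : 'rV[R]_n -> R) : \bar R :=
  (\int[lebesgue_tuple n]_(t in setT) (f (row_of_tuple t))%:E)%E.

(* The norm that the library puts on 'rV[R]_n is the sup norm. *)
Definition euclidean_norm x : R := Num.sqrt (\sum_i x 0 i ^+ 2).

Definition unit_ball : set 'rV[R]_n := [set x | euclidean_norm x <= 1].

Definition boundary A : set 'rV[R]_n := closure A `\` A°.

Definition convex_extended (psi : 'rV[R]_n -> \bar R) :=
  forall x y (t : R), 0 <= t -> t <= 1 ->
    (psi (t *: x + (1 - t) *: y)%R <= t%:E * psi x + (1 - t)%:E * psi y)%E.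

(* expeR is the exponential on [-oo, +oo], with expeR -oo = 0. *)
Definition log_concave (f : 'rV[R]_n -> R) :=
  exists psi : 'rV[R]_n -> \bar R,
    [/\ forall x, psi x != -oo%E, convex_extended psi &
        forall x, (f x)%:E = expeR (- psi x)].

Definition upper_semicontinuous (f : 'rV[R]_n -> R) :=
  forall x (a : R), f x < a -> \forall y \near x, f y < a.

Definition ellipsoid E :=
  exists (M : 'M[R]_n) (b : 'rV[R]_n),
    M \in unitmx /\ E = [set x *m M + b | x in unit_ball].

Definition max_volume_ellipsoid K E :=
  [/\ ellipsoid E, E `<=` K &
      forall E', ellipsoid E' -> E' `<=` K -> (volume E' <= volume E)%E].

Definition unique_max_volume_ellipsoid K E :=
  max_volume_ellipsoid K E /\ forall E', max_volume_ellipsoid K E' -> E' = E.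

End euclidean_space.

Arguments unit_ball : clear implicits.

Section subgraph.
Context {R : realType} {d : nat}.

(* A point of R^(d+1) is v = row_mx x xi with x = lsubmx v in R^d and
   xi = rsubmx v; thus lsubmx is the orthogonal projection onto R^d. *)
Definition symmetrized_subgraph (f : 'rV[R]_d -> R) : set 'rV[R]_(d + 1) :=
  [set v | `|(rsubmx v : 'rV[R]_1) 0 0| <= f (lsubmx v) / 2].

End subgraph.

(* Main.v *)
Require Import Defs.
From mathcomp Require Import all_boot all_order all_algebra.
From mathcomp Require Import all_classical all_reals all_analysis measurable_realfun.
From mathcomp Require Import ring lra.

Set Implicit Arguments.
Unset Strict Implicit.
Unset Printing Implicit Defensive.

Import Order.TTheory GRing.Theory Num.Theory.
Import numFieldNormedType.Exports.
Local Open Scope classical_set_scope.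
Local Open Scope ring_scope.

(* If the John-type decomposition fails, a Caratheodory and separation argument
   in the space of pairs (matrix, vector) yields a perturbation
   x |-> x (1 + e H) + e z of the ball with tr H > 0 that moves every contact
   point strictly inwards. For small e > 0 the perturbed ball stays inside the
   body by compactness, and its volume is larger.

   Conversely, every ellipsoid is B T + b with T upper triangular with positive
   diagonal (Cholesky). Log-concavity replaces the supporting half-space at a
   contact point (x, s), s > 0, by the bound f(y)/2 <= s exp(-<x, y - x>/s^2),
   and at a contact point (x, 0) by the half-space <x, y> <= 1 containing the
   support of f. Evaluated at the image of the contact point in the ellipsoid
   and summed with the weights, these give ln t + tr A <= d, where t is the last
   diagonal entry of T and A the remaining d x d block, whence det T <= 1
   because ln a <= a - 1. In the equality case first-order optimality at the
   contact points makes A symmetric, hence the identity, and removes the shear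
   and the translation. *)

(** * Lebesgue measure under triangular affine maps *)

(** The pushforward of Lebesgue measure scaled by [a] gives half-open intervals their length, and
    this determines Lebesgue measure. *)
Lemma lebesgue_measure_affine (R : realType) (a b : R) (A : set (measurableTypeR R)) :
  0 < a -> measurable A ->
  (a%:E * lebesgue_measure ((fun x : R => a * x + b)%R @^-1` A) = lebesgue_measure A)%E.
Proof.
move=> a0 mA.
have mf : measurable_fun [set: measurableTypeR R]
    (fun x : measurableTypeR R => a * x + b : measurableTypeR R).
  by apply: measurable_funD => //; apply: measurable_funM.
pose f := fun x : measurableTypeR R => a * x + b : measurableTypeR R.
pose k : {nonneg R} := NngNum (ltW a0).
have := @lebesgue_measure_unique R (mscale k (pushforward lebesgue_measure f)).
move=> /(_ mf _ A mA) -> //.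
move=> _ [[x y] /= _ <-].
rewrite /mscale /= /pushforward.
have pre : f @^-1` `]x, y] = `](x - b) / a, (y - b) / a]%classic.
  by apply/seteqP; split => z /=; rewrite !in_itv/= ltr_pdivrMr// ler_pdivlMr//
    ltrBlDr lerBrDr [z * a]mulrC.
have itvE u v : lebesgue_measure (`]u, v]%classic : set (measurableTypeR R)) =
    (if u < v then v - u else 0)%:E.
  by rewrite [LHS]lebesgue_measure_itv/= lte_fin; case: ifP.
apply: (etrans (itvE x y)); rewrite pre.
apply/esym; apply: (etrans (congr1 (fun e => a%:E * e)%E (itvE _ _))).
rewrite ltr_pM2r ?invr_gt0// ltrD2r -EFinM; congr EFin.
by case: ifP => _; [field; exact: lt0r_neq0|rewrite mulr0].
Qed.

Definition tuple_of_row (R : realType) n (v : 'rV[R]_n) :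
  n.-tuple (measurableTypeR R) := [tuple v 0 i | i < n].

Lemma tuple_of_rowK (R : realType) n : cancel (@tuple_of_row R n) (@row_of_tuple R n).
Proof. by move=> v; apply/rowP => i; rewrite mxE tnth_mktuple. Qed.

Lemma measurable_row_affine (R : realType) n m (U : 'M[R]_(n, m)) (b : 'rV_m) j :
  measurable_fun [set: n.-tuple (measurableTypeR R)]
    (fun t => (row_of_tuple t *m U + b) 0 j).
Proof.
under eq_fun do rewrite !mxE.
apply: measurable_funD => //; apply: measurable_sum => i.
apply: measurable_funM => //.
under eq_fun do rewrite mxE.
exact: measurable_tnth.
Qed.

Definition tuple_affine (R : realType) n (U : 'M[R]_n) (b : 'rV_n)
  (t : n.-tuple (measurableTypeR R)) := tuple_of_row (row_of_tuple t *m U + b).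

Lemma measurable_tuple_affine (R : realType) n (U : 'M[R]_n) (b : 'rV_n) :
  measurable_fun setT (@tuple_affine R n U b).
Proof.
apply/measurable_fun_tnthP => i.
rewrite (_ : _ \o _ = fun t => (row_of_tuple t *m U + b) 0 i).
  exact: measurable_row_affine.
by apply/funext => t /=; rewrite tnth_mktuple.
Qed.

Definition upper_triangular (R : realType) n (U : 'M[R]_n) :=
  forall i j : 'I_n, (j < i)%N -> U i j = 0.

Lemma tuple_affine_cons (R : realType) n (U : 'M[R]_n.+1) (b : 'rV_n.+1) x
    (t : n.-tuple (measurableTypeR R)) :
  upper_triangular U ->
  tuple_affine U b [tuple of x :: t] =
  [tuple of U 0 0 * x + b 0 0 ::
    tuple_affine (\matrix_(i, j) U (lift 0 i) (lift 0 j))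
      (\row_j (x * U 0 (lift 0 j) + b 0 (lift 0 j))) t].
Proof.
move=> hU; apply: eq_from_tnth => i; rewrite tnth_mktuple !mxE big_ord_recl.
rewrite mxE tnth0; case: (unliftP 0 i) => [j|] ->.
  rewrite tnthS tnth_mktuple !mxE addrAC [RHS]addrC; congr (_ + _).
  by apply: eq_bigr => k _; rewrite !mxE tnthS.
rewrite tnth0 big1 ?addr0 ?[x * _]mulrC// => k _.
by rewrite hU ?mulr0.
Qed.

(** Induction by sections. By triangularity the first image coordinate depends on the first
    coordinate [x] alone; for fixed [x] the others undergo a triangular map whose translation
    absorbs [x]. *)
Lemma lebesgue_tuple_affine (R : realType) n (U : 'M[R]_n) (b : 'rV_n)
    (A : set (n.-tuple (measurableTypeR R))) :
  upper_triangular U -> (forall i, 0 < U i i) -> measurable A ->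
  ((\prod_i U i i)%:E * lebesgue_tuple n (tuple_affine U b @^-1` A) =
    lebesgue_tuple n A)%E.
Proof.
elim: n U b A => [|n IH] U b A hU U0 mA.
  rewrite big_ord0 mul1e; congr (lebesgue_tuple _ _).
  apply/seteqP; split => t;
  by rewrite /preimage /= (tuple0 (tuple_affine _ _ _)) (tuple0 t).
pose U' : 'M[R]_n := \matrix_(i, j) U (lift 0 i) (lift 0 j).
pose b' x : 'rV[R]_n := \row_j (x * U 0 (lift 0 j) + b 0 (lift 0 j)).
pose S x := [set t : n.-tuple (measurableTypeR R) | A [tuple of x :: t]].
pose g x := lebesgue_tuple n (S x).
have mA' : measurable (@tuple_of_pair R n @^-1` A).
  by rewrite -[X in measurable X]setTI; exact: measurable_tuple_of_pair.
have Sxs x : xsection (@tuple_of_pair R n @^-1` A) x = S x.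
  by apply/seteqP; split=> t; rewrite xsectionE.
have mS x : measurable (S x) by rewrite -Sxs; exact: measurable_xsection.
have mg : measurable_fun setT g.
  rewrite (_ : g = lebesgue_tuple n \o xsection (@tuple_of_pair R n @^-1` A)).
    exact: measurable_fun_xsection.
  by apply/funext => x /=; rewrite Sxs.
have -> : lebesgue_tuple n.+1 A = (\int[lebesgue_measure]_x g x)%E.
  by rewrite /= /lebesgue_cons /pushforward; apply: eq_integral => x _ /=; rewrite Sxs.
have mf : measurable_fun [set: measurableTypeR R]
    (fun x : measurableTypeR R => U 0 0 * x + b 0 0 : measurableTypeR R).
  by apply: measurable_funD => //; apply: measurable_funM.
have -> : (lebesgue_tuple n.+1 (tuple_affine U b @^-1` A) =
    \int[lebesgue_measure]_x lebesgue_tuple n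
      (tuple_affine U' (b' x) @^-1` S (U 0 0 * x + b 0 0)%R))%E.
  rewrite /= /lebesgue_cons /pushforward; apply: eq_integral => x _ /=.
  congr (lebesgue_tuple _ _); apply/seteqP.
  by split=> t; rewrite xsectionE /preimage /= /tuple_of_pair/= tuple_affine_cons.
rewrite big_ord_recl EFinM -muleA.
have U'0 : 0 < \prod_i U' i i by apply: prodr_gt0 => i _; rewrite mxE.
have U'E : \prod_(i < n) U (lift ord0 i) (lift ord0 i) = \prod_i U' i i.
  by apply: eq_bigr => i _; rewrite mxE.
have IH' x : lebesgue_tuple n (tuple_affine U' (b' x) @^-1` S (U 0 0 * x + b 0 0)) =
    ((\prod_i U' i i)^-1%:E * g (U 0 0 * x + b 0 0)%R)%E.
  rewrite /g -[in RHS](IH U' (b' x)) ?muleA -?EFinM ?mulVf ?mul1e ?lt0r_neq0//.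
  - by move=> i j ij; rewrite mxE hU.
  - by move=> i; rewrite mxE.
under eq_integral do rewrite IH'.
rewrite ge0_integralZl//; last 2 first.
- exact: (measurableT_comp mg mf).
- by rewrite lee_fin invr_ge0 ltW.
rewrite U'E !muleA -!EFinM -mulrA divff ?lt0r_neq0// mulr1.
(* What is left is a one-dimensional substitution: scaling by [U 0 0] the pushforward under [f]
   gives back Lebesgue measure. *)
pose f := fun x : measurableTypeR R => U 0 0 * x + b 0 0 : measurableTypeR R.
pose mu : {measure set (measurableTypeR R) -> \bar R} := pushforward lebesgue_measure f.
pose k : {nonneg R} := NngNum (ltW (U0 0)).
have /= <- := @ge0_integral_pushforward _ _ _ _ _ _ mf lebesgue_measure setT g
  measurableT mg (fun y _ => measure_ge0 _ _).
rewrite -(@ge0_integral_mscale _ _ _ (mu mf) setT measurableT k)//.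
apply: eq_measure_integral => B mB _.
exact: (lebesgue_measure_affine (b 0 0) (U0 0) mB).
Qed.

(** * The dot product and the volume of the unit ball *)

Lemma cvg_sumr (R : realType) (V : normedModType R) (T : Type) (F : set_system T)
    (I : finType) (f : I -> T -> V) (a : I -> V) {FF : Filter F} :
  (forall i, f i x @[x --> F] --> a i) ->
  \sum_i f i x @[x --> F] --> \sum_i a i.
Proof.
by move=> fa; apply: cvg_big => [|i _]; [exact: add_continuous|exact: fa].
Qed.

Definition dot (R : realType) n (x y : 'rV[R]_n) : R := \sum_i x 0 i * y 0 i.

Section dot_product.
Context {R : realType} {n : nat}.
Implicit Types (x y z : 'rV[R]_n).

Lemma dotC x y : dot x y = dot y x.
Proof. by apply: eq_bigr => i _; rewrite mulrC. Qed.

Lemma dotDl x y z : dot (x + y) z = dot x z + dot y z.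
Proof. by rewrite -big_split; apply: eq_bigr => i _; rewrite mxE mulrDl. Qed.

Lemma dotDr x y z : dot x (y + z) = dot x y + dot x z.
Proof. by rewrite !(dotC x) dotDl. Qed.

Lemma dotZl a x y : dot (a *: x) y = a * dot x y.
Proof. by rewrite mulr_sumr; apply: eq_bigr => i _; rewrite mxE mulrA. Qed.

Lemma dotZr a x y : dot x (a *: y) = a * dot x y.
Proof. by rewrite dotC dotZl dotC. Qed.

Lemma dotNl x y : dot (- x) y = - dot x y.
Proof. by rewrite -scaleN1r dotZl mulN1r. Qed.

Lemma dotNr x y : dot x (- y) = - dot x y.
Proof. by rewrite dotC dotNl dotC. Qed.

Lemma dot0l x : dot 0 x = 0.
Proof. by rewrite -(scale0r x) dotZl mul0r. Qed.

Lemma dot0r x : dot x 0 = 0.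
Proof. by rewrite dotC dot0l. Qed.

Lemma dot_ge0 x : 0 <= dot x x.
Proof. by apply: sumr_ge0 => i _; rewrite -expr2 sqr_ge0. Qed.

Lemma dot_eq0 x : (dot x x == 0) = (x == 0).
Proof.
apply/idP/eqP => [|->]; last by rewrite dot0l.
rewrite psumr_eq0 => [/allP h|i _]; last by rewrite -expr2 sqr_ge0.
apply/rowP => i; rewrite mxE; apply/eqP.
by have := h i (mem_index_enum _); rewrite mulf_eq0 orbb.
Qed.

Lemma dot_suml (I : finType) (F : I -> 'rV[R]_n) y :
  dot (\sum_i F i) y = \sum_i dot (F i) y.
Proof.
by elim/big_rec2 : _ => [|i u v _ <-]; [rewrite dot0l|rewrite dotDl].
Qed.

Lemma continuous_dotxx : continuous (fun x => dot x x).
Proof.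
move=> y; apply: (@cvg_sumr _ _ _ (nbhs y) _ (fun i y => y 0 i * y 0 i)) => i.
by apply: cvgM; exact: coord_continuous.
Qed.

Lemma unit_ballE x : unit_ball R n x = (dot x x <= 1).
Proof.
rewrite /unit_ball /= /euclidean_norm -[X in _ <= X]sqrtr1 ler_sqrt ?ltr01 //.
Qed.

End dot_product.

Lemma dot_mulmx (R : realType) n m (x : 'rV[R]_n) (A : 'M[R]_(n, m)) (y : 'rV_m) :
  dot (x *m A) y = dot x (y *m A^T).
Proof.
rewrite /dot; under eq_bigr do rewrite mxE mulr_suml.
rewrite exchange_big; apply: eq_bigr => i _; rewrite mxE mulr_sumr.
by apply: eq_bigr => j _; rewrite mxE -mulrA [A i j * _]mulrC.
Qed.

Lemma dot_mxE (R : realType) n (x y : 'rV[R]_n) : dot x y = (x *m y^T) 0 0.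
Proof. by rewrite mxE; apply: eq_bigr => i _; rewrite mxE. Qed.

Lemma measurable_unit_ball (R : realType) n :
  measurable (@row_of_tuple R n @^-1` unit_ball R n).
Proof.
have -> : @row_of_tuple R n @^-1` unit_ball R n =
    (fun t => \sum_(i < n) tnth t i * tnth t i) @^-1` `]-oo, 1]%classic.
  apply/funext => t; rewrite /preimage /mkset unit_ballE in_itv/=.
  by congr (is_true (_ <= 1)); apply: eq_bigr => i _; rewrite !mxE.
rewrite -[X in measurable X]setTI.
suff : measurable_fun setT
   (fun t : n.-tuple (measurableTypeR R) => \sum_(i < n) tnth t i * tnth t i : R).
  by apply => //; exact: measurable_itv.
apply: measurable_sum => i.
by apply: measurable_funM; exact: measurable_tnth.
Qed.

(** Cubes containing, or contained in, the unit ball show that its volume is finite and positive;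
    its exact value never enters. *)
Lemma lebesgue_tuple_cube (R : realType) n (a : R) :
  0 <= a ->
  measurable [set t : n.-tuple (measurableTypeR R) | forall i, `|tnth t i| <= a] /\
  lebesgue_tuple n [set t | forall i, `|tnth t i| <= a] = ((a + a) ^+ n)%:E.
Proof.
move=> a0.
have [] := @lebesgue_tuple_box R n (fun=> `[- a, a]%classic)
  (fun=> measurable_itv _).
have -> : [set t : n.-tuple (measurableTypeR R) |
    forall i, `[- a, a]%classic (tnth t i)] = [set t | forall i, `|tnth t i| <= a].
  by apply/seteqP; split => t /= h i; have := h i; rewrite /= in_itv/= ler_norml.
move=> mC ->; split => //.
have -> : lebesgue_measure (`[- a, a]%classic : set (measurableTypeR R)) = (a + a)%:E.
  rewrite [LHS]lebesgue_measure_itv/= lte_fin; case: ifPn => [_|].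
    by rewrite opprK.
  by rewrite -leNgt => ?; congr EFin; lra.
by rewrite -[in RHS](card_ord n) -prodr_const -prodEFin.
Qed.

Lemma volume_unit_ball_fin (R : realType) n : (volume (unit_ball R n) < +oo)%E.
Proof.
have [mC vC] := @lebesgue_tuple_cube R n 1 ler01.
apply: (@le_lt_trans _ _ ((1 + 1) ^+ n)%:E); last exact: ltry.
rewrite -vC; apply: le_measure; rewrite ?inE//; first exact: measurable_unit_ball.
move=> t; rewrite /preimage /mkset unit_ballE => h i.
rewrite -(@expr_le1 _ 2)// real_normK ?num_real//.
apply: le_trans h; rewrite /dot (bigD1 i)//= !mxE -expr2 lerDl.
by apply: sumr_ge0 => j _; rewrite -expr2 sqr_ge0.
Qed.

Lemma volume_unit_ball_gt0 (R : realType) n : (0 < volume (unit_ball R n))%E.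
Proof.
(* Since [e <= 1], a point of the cube has squared norm at most [n * e <= 1]. The successor keeps
   [e] positive for [n = 0], where [0^-1] would be 0. *)
pose e : R := n.+1%:R^-1.
have e0 : 0 < e by rewrite invr_gt0.
have [mC vC] := @lebesgue_tuple_cube R n e (ltW e0).
apply: (@lt_le_trans _ _ ((e + e) ^+ n)%:E).
  by rewrite lte_fin exprn_gt0// addr_gt0.
rewrite -vC; apply: le_measure; rewrite ?inE//; first exact: measurable_unit_ball.
move=> t /= h; rewrite /preimage /mkset unit_ballE.
apply: (@le_trans _ _ (\sum_(i < n) e)).
  apply: ler_sum => i _; rewrite mxE -expr2 -real_normK ?num_real//.
  have he : `|tnth t i| <= e by exact: h.
  rewrite expr2 (le_trans (ler_pM _ _ he he))// ler_piMl// ?(ltW e0)//.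
  by rewrite /e invf_le1 ?ltr0n// ler1n.
rewrite sumr_const card_ord -mulr_natl /e ler_pdivrMr ?ltr0n// mul1r ler_nat.
exact: leqnSn.
Qed.

(** The affine map pulls the ellipsoid back to the ball, so the triangular change of variables
    applies. Measurability comes from the inverse map, under which the ellipsoid is the preimage of
    the ball. *)
Lemma volume_ellipsoid (R : realType) n (U : 'M[R]_n) (b : 'rV_n) :
  upper_triangular U -> (forall i, 0 < U i i) ->
  U \in unitmx ->
  (volume [set (x *m U + b)%R | x in unit_ball R n] =
    (\prod_i U i i)%:E * volume (unit_ball R n))%E.
Proof.
move=> hU U0 uU; set E := image _ _.
have mE : measurable (@row_of_tuple R n @^-1` E).
  have -> : @row_of_tuple R n @^-1` E =
      tuple_affine (invmx U) (- (b *m invmx U)) @^-1` (@row_of_tuple R n @^-1` unit_ball R n).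
    apply/seteqP; split => t; rewrite /preimage /mkset /tuple_affine tuple_of_rowK.
      by move=> [x ? <-]; rewrite mulmxDl mulmxK// addrK.
    move=> h; exists (row_of_tuple t *m invmx U - b *m invmx U) => //.
    by rewrite mulmxBl !mulmxKV// subrK.
  rewrite -[X in measurable X]setTI; apply: measurable_tuple_affine => //.
  exact: measurable_unit_ball.
rewrite /volume -(lebesgue_tuple_affine b hU U0 mE); congr (_ * lebesgue_tuple _ _)%E.
apply/seteqP; split => t; rewrite /preimage /mkset /tuple_affine tuple_of_rowK.
  move=> [x xB /addIr /(can_inj (mulmxK uU)) <-] //.
by move=> h; exists (row_of_tuple t).
Qed.

(** * Triangular parametrization of ellipsoids *)

(** Induction on the size: the lower right block of the factor is the factor of the Schur complement
    of the corner entry [s]. *)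
Lemma cholesky (R : realType) n (S : 'M[R]_n) :
  S^T = S -> (forall x : 'rV_n, x != 0 -> 0 < dot (x *m S) x) ->
  exists T : 'M[R]_n,
    [/\ upper_triangular T, forall i, 0 < T i i & T^T *m T = S].
Proof.
elim: n S => [|n IH] S symS posS.
  exists 0; split; [by case|by case|by apply/matrixP; case].
move: S symS posS; rewrite -[n.+1]/(1 + n)%N => S symS posS.
pose s := S 0 0; pose r : 'M[R]_(1, n) := ursubmx S; pose S' : 'M[R]_n := drsubmx S.
have symS' : S'^T = S' by rewrite trmx_drsub symS.
have SE : S = block_mx s%:M r r^T S'.
  rewrite -[LHS]submxK; congr block_mx; last by rewrite trmx_ursub symS.
  by rewrite [LHS]mx11_scalar !mxE !lshift0.
have s0 : 0 < s.
  have := posS (delta_mx 0 0); rewrite dot_mxE trmx_delta -rowE -colE !mxE; apply.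
  by apply/eqP => /matrixP/(_ 0 0); rewrite !mxE => /eqP; rewrite oner_eq0.
have sn0 := lt0r_neq0 s0.
have [|y y0|T' [uT' T'0 T'E]] := IH (S' - s^-1 *: (r^T *m r)).
- by rewrite linearB/= linearZ/= trmx_mul trmxK symS'.
(* This [c] cancels the first block of the image, so the form of [S] at [row_mx c y] is the form of
   the Schur complement at [y]. *)
- pose c : 'M[R]_1 := - (s^-1 *: (y *m r^T)).
  have := posS (row_mx c y); rewrite {1}SE mul_row_block.
  have -> : c *m s%:M + y *m r^T = 0.
    by rewrite mul_mx_scalar /c scalerN scalerA mulfV// scale1r addNr.
  rewrite !dot_mxE tr_row_mx mul_row_col mul0mx add0r mulmxBr.
  have -> : c *m r = - (y *m (s^-1 *: (r^T *m r))).
    by rewrite /c mulNmx -scalemxAl -scalemxAr mulmxA.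
  rewrite [- _ + _]addrC; apply.
  by apply: contraNneq y0 => /eqP; rewrite row_mx_eq0 => /andP[].
pose q := Num.sqrt s.
have q0 : 0 < q by rewrite sqrtr_gt0.
have qq : q * q = s by rewrite -expr2 sqr_sqrtr// ltW.
exists (block_mx q%:M (q^-1 *: r) 0 T'); split.
- move=> i j; case: (split_ordP i) => i' ->; case: (split_ordP j) => j' ->.
  + by rewrite !ord1.
  + by rewrite ord1.
  + by rewrite block_mxEdl mxE.
  + by rewrite block_mxEdr /= ltn_add2l; exact: uT'.
- move=> i; case: (split_ordP i) => i' ->; last by rewrite block_mxEdr.
  by rewrite block_mxEul ord1 mxE eqxx.
- rewrite tr_block_mx mulmx_block !trmx0 !mul0mx !mulmx0 !addr0 tr_scalar_mx.
  have -> : (q^-1 *: r)^T = q^-1 *: r^T by rewrite linearZ.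
  rewrite -scalar_mxM qq T'E mul_mx_scalar mul_scalar_mx !scalerA.
  rewrite -scalemxAl -scalemxAr scalerA mulfV ?lt0r_neq0// !scale1r.
  by rewrite -invfM qq addrC subrK -SE.
Qed.

Lemma upper_triangular_det (R : realType) n (T : 'M[R]_n) :
  upper_triangular T -> \det T = \prod_i T i i.
Proof.
move=> uT; rewrite -det_tr det_trig.
  by apply: eq_bigr => i _; rewrite mxE.
by apply/is_trig_mxP => i j ij; rewrite mxE uT.
Qed.

Lemma upper_triangular_unit (R : realType) n (T : 'M[R]_n) :
  upper_triangular T -> (forall i, 0 < T i i) -> T \in unitmx.
Proof.
move=> uT T0; rewrite unitmxE upper_triangular_det// unitfE.
by rewrite prodf_seq_neq0; apply/allP => i _; exact: lt0r_neq0.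
Qed.

(** The Cholesky factor [T] of [M^T *m M] satisfies [M = Q *m T] with [Q] orthogonal, and [Q] maps
    the ball onto itself. *)
Lemma ellipsoid_upper_triangular (R : realType) n (E : set 'rV[R]_n) :
  ellipsoid E -> exists (T : 'M[R]_n) (b : 'rV_n),
    [/\ upper_triangular T, forall i, 0 < T i i &
        E = [set x *m T + b | x in unit_ball R n]].
Proof.
move=> [M [b [uM ->]]].
have [|x x0|T [uT T0 TE]] := @cholesky R n (M^T *m M).
- by rewrite trmx_mul trmxK.
- rewrite mulmxA dot_mulmx lt_neqAle dot_ge0 andbT eq_sym dot_eq0.
  apply: contraNneq x0 => /(congr1 (mulmx^~ (invmx M^T))).
  by rewrite mulmxK ?unitmx_tr// mul0mx => ->.
have iT := upper_triangular_unit uT T0.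
exists T, b; split => //.
pose Q := M *m invmx T.
have QT : Q *m T = M by rewrite mulmxKV.
have QQ : Q *m Q^T = 1%:M.
  apply: mulmx1C; rewrite /Q trmx_mul trmx_inv mulmxA -[X in X *m _]mulmxA -TE.
  by rewrite mulmxA mulVmx ?unitmx_tr// mul1mx mulmxV.
have dotQ x : dot (x *m Q) (x *m Q) = dot x x.
  by rewrite dot_mulmx -mulmxA QQ mulmx1.
have uQ : Q \in unitmx by have [] := mulmx1_unit QQ.
apply/seteqP; split => _ [x xB <-].
  exists (x *m Q); last by rewrite -mulmxA QT.
  by move: xB; rewrite !unit_ballE dotQ.
exists (x *m invmx Q); last by rewrite -QT mulmxA mulmxKV.
by move: xB; rewrite !unit_ballE -[dot (_ *m _) _]dotQ mulmxKV.
Qed.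

(** * Separation from the convex hull of a compact set *)

(** Replaces passing to the limit [e -> 0] wherever a first-order condition is extracted from an
    inequality with a remainder. *)
Lemma le0_of_small (R : realType) (x y d : R) :
  0 < d -> (forall e, 0 < e -> e < d -> x <= e * y) -> x <= 0.
Proof.
move=> d0 h; apply/ler_addgt0Pr => e e0; rewrite add0r.
have y1 : 0 < `|y| + 1 by rewrite ltr_wpDl.
pose t := Num.min (d / 2) (e / (`|y| + 1)).
have t0 : 0 < t by rewrite lt_min !divr_gt0.
have td : t < d by rewrite gt_min; apply/orP; left; lra.
apply: (le_trans (h t t0 td)); apply: (@le_trans _ _ (t * (`|y| + 1))).
  by rewrite ler_pM2l// (le_trans (ler_norm y))// lerDl.
by rewrite -ler_pdivlMr// /t ge_min lexx orbT.
Qed.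

Lemma continuous_mx_coord (T : topologicalType) m n i j :
  continuous (fun M : 'M[T]_(m, n) => M i j).
Proof.
move=> M s sM; exists (fun i' j' => [set x | i' = i -> j' = j -> s x]).
  move=> i' j'; have [->|ni] := eqVneq i' i; have [->|nj] := eqVneq j' j.
  - by apply: filterS sM => x sx.
  - by apply: filterE => x _ /eqP; rewrite (negbTE nj).
  - by apply: filterE => x /eqP; rewrite (negbTE ni).
  - by apply: filterE => x /eqP; rewrite (negbTE ni).
by move=> N /(_ i j); exact.
Qed.

(** The number of terms is fixed and weights may vanish, so that over a compact [A] the parameters
    form a compact set. *)
Definition convex_combination (R : realType) N k (A : set 'rV[R]_N) (q : 'rV[R]_N) :=
  exists (w : 'I_k -> R) (u : 'I_k -> 'rV[R]_N),
    [/\ forall i, 0 <= w i, forall i, A (u i), \sum_i w i = 1 &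
        q = \sum_i w i *: u i].

(** Appending a coordinate 1 turns the points into [N.+2] rows of length [N + 1], which are linearly
    dependent. *)
Lemma affine_dependence (R : realType) N (u : 'I_N.+2 -> 'rV[R]_N) :
  exists l : 'I_N.+2 -> R,
    [/\ exists i, l i != 0, \sum_i l i = 0 & \sum_i l i *: u i = 0].
Proof.
pose A : 'M[R]_(N.+2, N + 1) := \matrix_i row_mx (u i) 1.
have /rowV0Pn[v /sub_kermxP vA v0] : kermx A != 0.
  rewrite kermx_eq0 /row_free; apply: contraTneq (rank_leq_col A) => ->.
  by rewrite addn1 ltnn.
have lE : \sum_i v 0 i *: row_mx (u i) 1 = 0 :> 'rV_(N + 1).
  by rewrite -[RHS]vA mulmx_sum_row; apply: eq_bigr => i _; rewrite rowK.
exists (fun i => v 0 i); split.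
- by have /rV0Pn := v0.
- have /(congr1 (fun x : 'rV_(N + 1) => rsubmx x 0 0)) := lE.
  rewrite linear_sum/= summxE !mxE => {2}<-; apply: eq_bigr => i _.
  by rewrite linearZ/= row_mxKr !mxE mulr1.
- have /(congr1 lsubmx) := lE.
  rewrite linear_sum linear0/= => {2}<-; apply: eq_bigr => i _.
  by rewrite linearZ/= row_mxKl.
Qed.

(** Shifting the weights along an affine dependence keeps their sum and the combination; the shift
    stops when a first weight vanishes. *)
Lemma caratheodory (R : realType) N (A : set 'rV[R]_N) q :
  convex_combination N.+2 A q -> convex_combination N.+1 A q.
Proof.
move=> [w [u [w0 Au w1 ->]]].
have [l [[i1 l_i1] l0 lu0]] := affine_dependence u.
have [i2 l_i2] : exists i, 0 < l i.
  apply: contrapT => /forallNP ln0.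
  have {}ln0 i : l i <= 0 by rewrite leNgt; apply/negP.
  have : \sum_i (- l i) = 0 by rewrite sumrN l0 oppr0.
  move/eqP; rewrite psumr_eq0 => [/allP/(_ i1 (mem_index_enum _))|i _].
    by rewrite /= oppr_eq0 (negbTE l_i1).
  by rewrite oppr_ge0.
case: (@arg_minP _ _ _ i2 (fun i => 0 < l i) (fun i => w i / l i) l_i2) => i0 l_i0 min_i0.
(* The least ratio over positive [l i] is the largest shift that keeps all weights nonnegative. *)
pose t := w i0 / l i0.
pose w' i := w i - t * l i.
have w'0 : w' i0 = 0 by rewrite /w' /t divfK ?subrr// lt0r_neq0.
have t0 : 0 <= t by rewrite divr_ge0// ltW.
exists (fun i => w' (lift i0 i)), (fun i => u (lift i0 i)); split => //.
- move=> i; set j := lift _ _; rewrite /w' subr_ge0.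
  have [lj0|lj0] := ltP 0 (l j); first by rewrite -ler_pdivlMr// min_i0.
  by apply: le_trans (w0 j); rewrite mulr_ge0_le0.
- have : \sum_i w' i = 1 by rewrite big_split/= w1 sumrN -mulr_sumr l0 mulr0 subr0.
  by rewrite (bigD1_ord i0)//= w'0 add0r.
- have : \sum_i w' i *: u i = \sum_i w i *: u i.
    under eq_bigr do rewrite scalerBl.
    rewrite big_split/= sumrN; under [in X in _ - X]eq_bigr do rewrite -scalerA.
    by rewrite -scaler_sumr lu0 scaler0 subr0.
  by rewrite (bigD1_ord i0)//= w'0 scale0r add0r => ->.
Qed.

(** The squared distance is continuous on the compact set of pairs of weights and points, hence
    attains its minimum. *)
Lemma nearest_convex_combination (R : realType) N k (A : set 'rV[R]_N) p :
  compact A -> A !=set0 ->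
  exists2 q, convex_combination k.+1 A q &
    forall q', convex_combination k.+1 A q' -> dot (p - q) (p - q) <= dot (p - q') (p - q').
Proof.
move=> cA [a Aa].
pose W := [set w : 'rV[R]_k.+1 | forall i, `[0, 1]%classic (w 0 i)].
pose V := [set u : 'rV['rV[R]_N]_k.+1 | forall i, A (u 0 i)].
pose Z := [set w : 'rV[R]_k.+1 * 'rV['rV[R]_N]_k.+1 | \sum_i w.1 0 i = 1].
have cW : compact W.
  by apply: (@rV_compact R _ (fun=> `[0, 1]%classic)) => _; exact: segment_compact.
have cV : compact V by exact: (@rV_compact _ _ (fun=> A)).
have wc i : continuous (fun x : 'rV[R]_k.+1 * 'rV['rV[R]_N]_k.+1 => x.1 0 i).
  move=> x; apply: (@continuous_comp _ _ _ fst (fun w : 'rV[R]_k.+1 => w 0 i)).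
    exact: cvg_fst.
  exact: coord_continuous.
have uc i : continuous (fun x : 'rV[R]_k.+1 * 'rV['rV[R]_N]_k.+1 => x.2 0 i).
  move=> x.
  apply: (@continuous_comp _ _ _ snd (fun u : 'rV['rV[R]_N]_k.+1 => u 0 i)).
    exact: cvg_snd.
  exact: continuous_mx_coord.
have clZ : closed Z.
  apply: (@closed_comp _ _ (fun x : 'rV[R]_k.+1 * 'rV['rV[R]_N]_k.+1 =>
    \sum_i x.1 0 i) [set 1]); last exact: closed_eq.
  by move=> x _; apply: (@cvg_sumr _ _ _ (nbhs x) _
    (fun i (x : 'rV[R]_k.+1 * 'rV['rV[R]_N]_k.+1) => x.1 0 i)) => i; exact: wc.
have cS : compact ((W `*` V) `&` Z).
  by apply: compact_closedI => //; exact: compact_setX.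
pose c (x : 'rV[R]_k.+1 * 'rV['rV[R]_N]_k.+1) := \sum_i x.1 0 i *: x.2 0 i.
have cc : continuous c.
  move=> x; apply: (@cvg_sumr _ _ _ (nbhs x) _
    (fun i (x : 'rV[R]_k.+1 * 'rV['rV[R]_N]_k.+1) => x.1 0 i *: x.2 0 i)) => i.
  by apply: cvgZ; [exact: wc|exact: uc].
have toS q : convex_combination k.+1 A q -> exists2 x, ((W `*` V) `&` Z) x & c x = q.
  move=> [w [u [w0 Au w1 ->]]]; exists (\row_i w i, \row_i u i).
    split; [split|] => /=.
    - move=> i /=; rewrite mxE in_itv/= w0/= -w1 (bigD1 i)//= lerDl.
      by apply: sumr_ge0.
    - by move=> i; rewrite mxE.
    - by rewrite /Z /= -[RHS]w1; apply: eq_bigr => i _; rewrite mxE.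
  by apply: eq_bigr => i _; rewrite !mxE.
have ofS x : ((W `*` V) `&` Z) x -> convex_combination k.+1 A (c x).
  move=> [[Wx Vx] Zx]; exists (fun i => x.1 0 i), (fun i => x.2 0 i); split => // i.
  by have := Wx i; rewrite /= in_itv => /andP[].
have S0 : ((W `*` V) `&` Z) !=set0.
  have [|x Sx _] := toS a; last by exists x.
  exists (fun i => (i == 0)%:R), (fun=> a); split => //.
  - by rewrite (bigD1 0)//= big1 ?addr0// => i /negbTE ->.
  - by rewrite (bigD1 0)//= big1 ?addr0 ?scale1r// => i /negbTE ->; rewrite scale0r.
have [|x /set_mem Sx xmin] := @compact_EVT_min _ R (fun x => dot (p - c x) (p - c x)) _ S0 cS.
  apply: continuous_subspaceT => x.
  apply: (@continuous_comp _ _ _ (fun x => p - c x) (fun y => dot y y)).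
    by apply: cvgB; [exact: cvg_cst|exact: cc].
  exact: continuous_dotxx.
exists (c x); first exact: ofS.
by move=> q' /toS[y Sy <-]; apply: xmin; exact: mem_set.
Qed.

(** Let [q] be a nearest combination. Either [p = q], or [p - q] separates with gap the squared
    distance, by the variational inequality for the nearest point. *)
Lemma convex_hull_separation (R : realType) N (A : set 'rV[R]_N) (p : 'rV[R]_N) :
  compact A ->
  (exists k (w : 'I_k -> R) (u : 'I_k -> 'rV[R]_N),
    [/\ forall i, 0 < w i, forall i, A (u i), \sum_i w i = 1 &
        p = \sum_i w i *: u i]) \/
  exists (l : 'rV[R]_N) (e : R), 0 < e /\ forall a, A a -> dot l a + e <= dot l p.
Proof.
move=> cA; have [A0|/set0P A0] := eqVneq A set0.
  by right; exists 0, 1; split => // a; rewrite A0.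
have [q qA qmin] := @nearest_convex_combination R N N A p cA A0.
have [pq|pq] := eqVneq p q.
  left; move: qA => [w [u [w0 Au w1 qE]]].
  (* Terms of weight zero are discarded to make all weights strictly positive. *)
  pose P := [pred i | 0 < w i].
  have Pw i : ~~ P i -> w i = 0.
    by rewrite /= lt_neqAle w0 andbT negbK => /eqP.
  exists #|P|, (fun i => w (enum_val i)), (fun i => u (enum_val i)); split => //.
  - by move=> i; exact: (enum_valP i).
  - rewrite -(big_enum_val (A := P) w) -[RHS]w1 [RHS](bigID P)/=.
    by rewrite [X in _ + X]big1 ?addr0// => i /Pw.
  - rewrite pq qE -(big_enum_val (A := P) (fun i => w i *: u i)) [LHS](bigID P)/=.
    by rewrite [X in _ + X]big1 ?addr0// => i /Pw ->; rewrite scale0r.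
right; exists (p - q), (dot (p - q) (p - q)); split.
  by rewrite lt_neqAle dot_ge0 andbT eq_sym dot_eq0 subr_eq0.
move=> a Aa.
suff : dot (p - q) (a - q) <= 0.
  by rewrite !(dotDr, dotNr, dotDl, dotNl) (dotC q p); lra.
apply: (@le0_of_small _ _ (dot (a - q) (a - q) / 2) 1) => // t t0 t1.
have : dot (p - q) (p - q) <=
    dot ((p - q) - t *: (a - q)) ((p - q) - t *: (a - q)).
  have -> : p - q - t *: (a - q) = p - (q + t *: (a - q)) by rewrite opprD addrA.
  (* Moving from [q] towards [a] costs one extra term; [caratheodory] removes it, so the minimality
     of [q] still applies. *)
  apply: qmin; apply: caratheodory.
  have [w [u [w0 Au w1 qE]]] := qA.
  exists (fun i => if unlift ord0 i is Some j then (1 - t) * w j else t).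
  exists (fun i => if unlift ord0 i is Some j then u j else a); split.
  - by move=> i; case: unliftP => [j|] _; rewrite ?mulr_ge0// ?ltW// subr_gt0.
  - by move=> i; case: unliftP.
  - rewrite big_ord_recl unlift_none; under eq_bigr do rewrite liftK.
    by rewrite -mulr_sumr w1 mulr1 addrC subrK.
  - rewrite big_ord_recl unlift_none; under eq_bigr do rewrite liftK -scalerA.
    by rewrite -scaler_sumr -qE scalerBr scalerBl scale1r addrA addrAC addrC.
move: (p - q) (a - q) => v z.
rewrite !(dotDl, dotDr, dotNl, dotNr, dotZl, dotZr) (dotC z v) => h.
suff : t * dot v z <= t * (t * (dot z z / 2)) by rewrite ler_pM2l.
by lra.
Qed.

(** * Perturbations of a maximum volume ball *)

Section cvg_row.
Context {R : realType} {T : Type} {F : set_system T} {FF : Filter F}.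

Lemma cvg_row_coord n (x : T -> 'rV[R]_n) (a : 'rV[R]_n) i :
  x t @[t --> F] --> a -> x t 0 i @[t --> F] --> a 0 i.
Proof.
move=> xa.
exact: (@cvg_comp _ _ _ x (fun u : 'rV[R]_n => u 0 i) _ _ _ xa (@coord_continuous R 1 n 0 i a)).
Qed.

Lemma cvg_rowP n (x : T -> 'rV[R]_n) (a : 'rV[R]_n) :
  (forall i, x t 0 i @[t --> F] --> a 0 i) -> x t @[t --> F] --> a.
Proof.
move=> xa; rewrite [a]row_sum_delta.
under eq_fun do rewrite [x _]row_sum_delta.
apply: (@cvg_sumr _ _ _ F _ (fun i t => x t 0 i *: delta_mx 0 i)) => i.
by apply: cvgZ; [exact: xa|exact: cvg_cst].
Qed.

Lemma cvg_mulmx n m (x : T -> 'rV[R]_n) (a : 'rV[R]_n) (H : 'M[R]_(n, m)) :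
  x t @[t --> F] --> a -> x t *m H @[t --> F] --> a *m H.
Proof.
move=> xa; rewrite mulmx_sum_row.
under eq_fun do rewrite mulmx_sum_row.
apply: (@cvg_sumr _ _ _ F _ (fun i t => x t 0 i *: row i H)) => i.
by apply: cvgZ; [exact: cvg_row_coord|exact: cvg_cst].
Qed.

Lemma cvg_dot n (x y : T -> 'rV[R]_n) (a b : 'rV[R]_n) :
  x t @[t --> F] --> a -> y t @[t --> F] --> b ->
  dot (x t) (y t) @[t --> F] --> dot a b.
Proof.
move=> xa yb; apply: (@cvg_sumr _ _ _ F _ (fun i t => x t 0 i * y t 0 i)) => i.
by apply: cvgM; exact: cvg_row_coord.
Qed.

End cvg_row.

Section unit_ball_topology.
Context {R : realType} {n : nat}.

Lemma closed_unit_ball : closed (unit_ball R n).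
Proof.
have -> : unit_ball R n = (fun x => dot x x) @^-1` [set y | y <= 1].
  by apply/funext => x; rewrite unit_ballE.
by apply: closed_comp => [x _|]; [exact: continuous_dotxx|exact: closed_le].
Qed.

Lemma compact_unit_ball : compact (unit_ball R n).
Proof.
apply: (subclosed_compact closed_unit_ball
  (@rV_compact R n (fun=> `[-1, 1]%classic) (fun=> @segment_compact _ _ _))).
move=> x; rewrite unit_ballE => h i /=; rewrite in_itv/= -ler_norml.
rewrite -(@expr_le1 _ 2)// real_normK ?num_real//.
apply: le_trans h; rewrite /dot (bigD1 i)//= -expr2 lerDl.
by apply: sumr_ge0 => j _; rewrite -expr2 sqr_ge0.
Qed.

Lemma interior_unit_ball x : dot x x < 1 -> (unit_ball R n)° x.
Proof.
move=> x1; have : (fun x : 'rV[R]_n => dot x x) @ x --> dot x x by exact: continuous_dotxx.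
move=> /cvgr_lt/(_ _ x1); apply: filterS => y /ltW.
by rewrite unit_ballE.
Qed.

Lemma boundary_unit_ball x : boundary (unit_ball R n) x -> dot x x = 1.
Proof.
move=> [clx nintx]; apply/eqP; rewrite eq_le.
apply/andP; split; first by rewrite -unit_ballE ((closure_id _).1 closed_unit_ball).
by rewrite leNgt; apply/negP => /interior_unit_ball.
Qed.

Lemma interior_of_noncontact (K : set 'rV[R]_n) v : unit_ball R n `<=` K ->
  unit_ball R n v -> ~ (boundary (unit_ball R n) `&` boundary K) v -> K° v.
Proof.
move=> BK Bv nc; apply: contrapT => nK; apply: nc; split; split => //.
- exact: subset_closure.
- by move=> /(interiorS BK).
- exact/subset_closure/BK.
Qed.

End unit_ball_topology.

(** Local at each point of the ball: near a contact point the perturbation shortens vectors to first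
    order, so they remain in the ball; any other point is interior to [K]. Compactness makes [e]
    uniform. *)
Lemma ellipsoid_near_unit_ball (R : realType) n (K : set 'rV[R]_n) (H : 'M[R]_n)
    (z : 'rV[R]_n) :
  unit_ball R n `<=` K ->
  (forall v, (boundary (unit_ball R n) `&` boundary K) v -> dot (v *m H) v + dot z v < 0) ->
  \forall e \near 0^'+,
    [set x *m (1%:M + e *: H) + e *: z | x in unit_ball R n] `<=` K.
Proof.
move=> BK contact.
have /compact_near_coveringP cB := @compact_unit_ball R n.
pose P e x := unit_ball R n x -> K (x *m (1%:M + e *: H) + e *: z).
suff : \forall e \near 0^'+, unit_ball R n `<=` P e.
  by apply: filterS => e h _ [x Bx <-]; exact: h.
apply: cB => v Bv.
have GE (x : 'rV[R]_n) e : x *m (1%:M + e *: H) + e *: z = x + e *: (x *m H + z).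
  by rewrite mulmxDr mulmx1 -scalemxAr scalerDr addrA.
pose F := filter_prod (nbhs v) (0 : R)^'+.
have cx : x.1 @[x --> F] --> v by exact: cvg_fst.
have ce : x.2 @[x --> F] --> (0 : R).
  by apply: cvg_trans; [exact: cvg_snd|exact: cvg_within].
have cw : x.1 *m H + z @[x --> F] --> v *m H + z.
  by apply: cvgD; [exact: cvg_mulmx|exact: cvg_cst].
have [cv|/(interior_of_noncontact BK Bv) Kv] :=
  pselect ((boundary (unit_ball R n) `&` boundary K) v).
(* This is the difference quotient in [e] of the squared norm of the perturbed point; its limit at a
   contact point is negative. *)
- have : 2 * (dot x.1 (x.1 *m H + z)) + x.2 * dot (x.1 *m H + z) (x.1 *m H + z)
      @[x --> F] --> 2 * (dot v (v *m H + z)) + 0 * dot (v *m H + z) (v *m H + z).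
    apply: cvgD; first by apply: cvgM; [exact: cvg_cst|exact: cvg_dot].
    by apply: cvgM => //; exact: cvg_dot.
  rewrite mul0r addr0 => /cvgr_lt/(_ 0).
  have q0 : 2 * dot v (v *m H + z) < 0.
    by have := contact v cv; rewrite dotDr (dotC v) (dotC v z); lra.
  move=> /(_ q0) neg.
  have pos : \forall x \near F, 0 < x.2.
    exists (setT, [set e | 0 < e]); last by move=> [x e] [].
    by split; [exact: filterT|exact: nbhs_right_gt].
  move: neg pos; apply: filterS2 => -[x e] /= neg e0 Bx.
  apply: BK; rewrite unit_ballE GE; move: Bx neg.
  rewrite unit_ballE; move: (x *m H + z) => w Bx neg.
  rewrite !(dotDl, dotDr, dotZl, dotZr) (dotC w x).
  have : e * (2 * dot x w + e * dot w w) <= 0 by rewrite pmulr_rle0// ltW.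
  lra.
- have : x.1 + x.2 *: (x.1 *m H + z) @[x --> F] --> v + 0 *: (v *m H + z).
    by apply: cvgD => //; exact: cvgZ.
  rewrite scale0r addr0 => cG.
  have : \forall x \near F, K (x.1 + x.2 *: (x.1 *m H + z)) by exact: cG.
  by apply: filterS => -[x e] /= Ge _; rewrite GE.
Qed.

Lemma prod_expR_ln (R : realType) n (x : 'I_n -> R) :
  (forall i, 0 < x i) -> \prod_i x i = expR (\sum_i ln (x i)).
Proof.
by move=> x0; rewrite expR_sum; apply: eq_bigr => i _; rewrite lnK// posrE.
Qed.

Lemma ln_le_subr1 (R : realType) (x : R) : 0 < x -> ln x <= x - 1.
Proof. by move=> x0; rewrite -[x in ln x](subrK 1) addrC le_ln1Dx//; lra. Qed.

Lemma ln_ge_1subV (R : realType) (x : R) : 0 < x -> 1 - x^-1 <= ln x.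
Proof.
move=> x0; have := @ln_le_subr1 _ x^-1; rewrite invr_gt0 lnV ?posrE// => /(_ x0).
lra.
Qed.

(** The logarithm of the product is at least [e] times the sum of [h i / (1 + e * h i)], by
    [1 - x^-1 <= ln x], and that sum tends to the positive sum of the [h i]. *)
Lemma prod_near_gt1 (R : realType) n (h : 'I_n -> R) : 0 < \sum_i h i ->
  \forall e \near 0^'+, (forall i, 0 < 1 + e * h i) /\ 1 < \prod_i (1 + e * h i).
Proof.
move=> h0.
have ce : e @[e --> (0 : R)^'+] --> (0 : R) by exact: cvg_within.
have c1 i : 1 + e * h i @[e --> (0 : R)^'+] --> (1 : R).
  rewrite -[X in _ --> X]addr0 -[X in _ --> _ + X](mul0r (h i)).
  by apply: cvgD; [exact: cvg_cst|apply: cvgM => //; exact: cvg_cst].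
have pos : \forall e \near (0 : R)^'+, forall i, 0 < 1 + e * h i.
  apply: filter_forall => i.
  exact: (cvgr_gt _ (c1 i) _ ltr01).
have : \sum_i h i / (1 + e * h i) @[e --> (0 : R)^'+] --> \sum_i h i / 1.
  apply: (@cvg_sumr _ _ _ _ _ (fun i e => h i / (1 + e * h i))) => i.
  apply: cvgM; first exact: cvg_cst.
  by apply: cvgV; [exact: oner_neq0|exact: c1].
under [X in _ --> X -> _]eq_bigr do rewrite divr1.
move=> /cvgr_gt/(_ _ h0) sum_gt0.
have egt0 : \forall e \near (0 : R)^'+, 0 < e by exact: nbhs_right_gt.
near=> e.
have e0 : 0 < e by near: e.
have pe : forall i, 0 < 1 + e * h i by near: e.
split => //; rewrite prod_expR_ln// expR_gt1.
apply: (@lt_le_trans _ _ (e * \sum_i h i / (1 + e * h i))).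
  by rewrite mulr_gt0//; near: e.
rewrite mulr_sumr; apply: ler_sum => i _; apply: le_trans (ln_ge_1subV (pe i)).
rewrite le_eqVlt; apply/orP; left; apply/eqP; field; exact: lt0r_neq0.
Unshelve. all: by end_near. Qed.

(* Only the quadratic form of a perturbation matters to first order, so it may
   be taken triangular, which turns its determinant into a product. *)
Lemma upper_triangular_same_form (R : realType) n (L : 'M[R]_n) :
  exists H : 'M[R]_n, [/\ upper_triangular H, forall i, H i i = L i i &
    forall v : 'rV_n, dot (v *m H) v = dot (v *m L) v].
Proof.
pose H : 'M[R]_n := \matrix_(i, j)
  (if (i < j)%N then L i j + L j i else if i == j then L i i else 0).
exists H; split => [i j ji|i|v].
- by rewrite mxE ltnNge (ltnW ji)/=; case: eqVneq ji => // ->; rewrite ltnn.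
- by rewrite mxE ltnn eqxx.
pose D := H - L.
have DT : D^T = - D.
  apply/matrixP => i j; rewrite !mxE.
  have [ij|ij|/val_inj ->] := ltngtP i j.
  - by rewrite (gtn_eqF ij : (j == i) = false); ring.
  - by rewrite (gtn_eqF ij : (i == j) = false); ring.
  - by rewrite eqxx; ring.
have : dot (v *m D) v = 0.
  have : dot (v *m D) v = - dot (v *m D) v.
    by rewrite [LHS]dot_mulmx DT mulmxN dotNr dotC.
  lra.
by rewrite mulmxBr dotDl dotNl => /eqP; rewrite subr_eq0 => /eqP.
Qed.

(** With positive trace, a small triangular perturbation with the same quadratic form would be a
    larger ellipsoid inside [K]. *)
Lemma max_volume_trace_le0 (R : realType) n (K : set 'rV[R]_n) (L : 'M[R]_n)
    (z : 'rV[R]_n) :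
  max_volume_ellipsoid K (unit_ball R n) ->
  (forall v, (boundary (unit_ball R n) `&` boundary K) v -> dot (v *m L) v + dot z v < 0) ->
  \tr L <= 0.
Proof.
move=> [_ BK maxB] contact; rewrite leNgt; apply/negP => L0.
have [H [uH HL vH]] := upper_triangular_same_form L.
have h0 : 0 < \sum_i H i i by under eq_bigr do rewrite HL.
have sub := @ellipsoid_near_unit_ball R n K H z BK.
have [|e [eK [epos eprod]]] := @filter_ex _ ((0 : R)^'+) _ _
  (filterI (sub _) (prod_near_gt1 h0)).
  by move=> v /contact; rewrite vH.
pose T := 1%:M + e *: H.
have TE i : T i i = 1 + e * H i i by rewrite !mxE eqxx.
have uT : upper_triangular T.
  move=> i j ji; rewrite !mxE uH// mulr0 addr0.
  by case: eqVneq ji => // ->; rewrite ltnn.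
have T0 i : 0 < T i i by rewrite TE.
have iT := upper_triangular_unit uT T0.
have := maxB [set x *m T + e *: z | x in unit_ball R n].
rewrite volume_ellipsoid//; apply/not_implyP; split; first by exists T, (e *: z).
apply/not_implyP; split => //; apply/negP; rewrite -ltNge.
rewrite -[ltLHS]mul1e lte_pmul2r ?volume_unit_ball_gt0//.
  by rewrite lte_fin (eq_bigr _ (fun i _ => TE i)).
by rewrite ge0_fin_numE ?volume_unit_ball_fin// ltW// volume_unit_ball_gt0.
Qed.

(** * John's decomposition for a ball of maximum volume *)

Lemma dot_row_mx (R : realType) n m (a c : 'rV[R]_n) (b e : 'rV[R]_m) :
  dot (row_mx a b) (row_mx c e) = dot a c + dot b e.
Proof.
rewrite /dot big_split_ord/=.
by congr (_ + _); apply: eq_bigr => i _; rewrite ?row_mxEl ?row_mxEr.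
Qed.

Lemma dot_mxvec (R : realType) n m (X Y : 'M[R]_(n, m)) :
  dot (mxvec X) (mxvec Y) = \sum_i \sum_j X i j * Y i j.
Proof.
rewrite /dot (reindex _ (curry_mxvec_bij _ _)) /= pair_bigA.
by apply: eq_bigr => -[i j] _; rewrite !mxvecE.
Qed.

Lemma dot_mxvec_outer (R : realType) n (L : 'M[R]_n) (v : 'rV[R]_n) :
  dot (mxvec L) (mxvec (v^T *m v)) = dot (v *m L) v.
Proof. by rewrite dotC dot_mxE mxvec_dotmul dot_mxE. Qed.

Lemma dot_mxvec_scalar (R : realType) n (L : 'M[R]_n) a :
  dot (mxvec L) (mxvec a%:M) = \tr L * a.
Proof.
rewrite dot_mxvec mulr_suml; apply: eq_bigr => i _.
rewrite (bigD1 i)//= mxE eqxx big1 ?addr0// => j ji.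
by rewrite mxE eq_sym (negbTE ji) mulr0.
Qed.

Lemma closed_boundary (R : realType) n (A : set 'rV[R]_n) : closed (boundary A).
Proof.
rewrite /boundary setDE; apply: closedI; first exact: closed_closure.
exact/open_closedC/open_interior.
Qed.

(** Separation is applied to the pairs of [v^T *m v] and [lsubmx v] over contact points [v]. Such
    matrices have trace 1, so the target is the identity divided by [n], paired with 0; weights are
    then rescaled by [n]. *)
Lemma john_decomposition_of_max_volume (R : realType) d (K : set 'rV[R]_(d + 1)) :
  max_volume_ellipsoid K (unit_ball R (d + 1)) ->
  exists (k : nat) (u : 'I_k -> 'rV[R]_(d + 1)) (c : 'I_k -> R),
    [/\ forall i, (boundary (unit_ball R (d + 1)) `&` boundary K) (u i),
        forall i, 0 < c i,
        \sum_(i < k) c i *: ((u i)^T *m u i) = 1%:M &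
        \sum_(i < k) c i *: (lsubmx (u i) : 'rV[R]_d) = 0].
Proof.
move=> maxB; have [_ BK _] := maxB.
pose n := (d + 1)%N.
have n0 : 0 < n%:R :> R by rewrite ltr0n /n addn1.
set C := boundary (unit_ball R n) `&` boundary K.
have cC : compact C.
  apply: (subclosed_compact _ (@compact_unit_ball R n)) => [|x [/boundary_unit_ball xx _]].
    by apply: closedI; exact: closed_boundary.
  by rewrite unit_ballE xx.
pose phi (v : 'rV[R]_n) : 'rV_(n * n + d) := row_mx (mxvec (v^T *m v)) (lsubmx v).
have cphi : continuous phi.
  move=> v; apply: (@cvg_rowP _ _ (nbhs v)) => j; case: (split_ordP j) => i ->.
    rewrite row_mxEl; under eq_fun do rewrite row_mxEl.
    case/mxvec_indexP: i => i k; rewrite mxvecE mxE big_ord1 mxE.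
    under eq_fun do rewrite mxvecE mxE big_ord1 mxE.
    by apply: cvgM; exact: coord_continuous.
  rewrite row_mxEr mxE; under eq_fun do rewrite row_mxEr mxE.
  exact: coord_continuous.
have cA : compact (phi @` C).
  by apply: continuous_compact => //; exact: continuous_subspaceT.
pose p : 'rV[R]_(n * n + d) := row_mx (mxvec (n%:R^-1)%:M) 0.
case: (convex_hull_separation p cA) => [[k [w [a [w0 aC w1 pE]]]]|[l [e [e0 le]]]].
  have [u uE] : {u : 'I_k -> 'rV[R]_n & forall i, C (u i) /\ phi (u i) = a i}.
    apply: (@choice _ _ (fun i v => C v /\ phi v = a i)) => i.
    by have [v] := aC i; exists v.
  exists k, u, (fun i => n%:R * w i); split.
  - by move=> i; have [] := uE i.
  - by move=> i; rewrite mulr_gt0.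
  - have := congr1 (fun x => n%:R *: vec_mx (lsubmx x)) pE.
    rewrite /p row_mxKl mxvecK scale_scalar_mx mulfV ?lt0r_neq0// => ->.
    rewrite !linear_sum; apply: eq_bigr => i _.
    by rewrite -(uE i).2 !linearZ/= row_mxKl mxvecK scalerA [w i * _]mulrC.
  - have := congr1 (fun x => n%:R *: rsubmx x) pE.
    rewrite /p row_mxKr scaler0 !linear_sum => E; rewrite [RHS]E.
    apply: eq_bigr => i _.
    by rewrite -(uE i).2 !linearZ/= row_mxKr scalerA [w i * _]mulrC.
pose L0 : 'M[R]_n := vec_mx (lsubmx l).
(* Subtracting [mu] spends half of the gap [e]: the form stays below [- e / 2] at contact points,
   while the trace becomes [n * e / 2 > 0]. *)
pose mu := \tr L0 / n%:R - e / 2.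
have : \tr (L0 - mu%:M) <= 0.
  apply: (max_volume_trace_le0 (z := row_mx (rsubmx l) 0) maxB) => v Cv.
  have vv : dot v v = 1 by apply: boundary_unit_ball; have [] := Cv.
  have := le (phi v) (ex_intro2 _ _ v Cv erefl).
  rewrite -[l]hsubmxK !dot_row_mx dot0r addr0 -[lsubmx l]vec_mxK -/L0.
  rewrite dot_mxvec_outer dot_mxvec_scalar.
  rewrite mulmxBr mul_mx_scalar dotDl dotNl dotZl vv.
  rewrite -[v in dot (row_mx _ _) v]hsubmxK dot_row_mx dot0l row_mxKr /mu.
  lra.
rewrite linearB/= mxtrace_scalar /mu.
have -> : (\tr L0 / n%:R - e / 2) *+ n = \tr L0 - n%:R * (e / 2).
  by rewrite -mulr_natl mulrBr mulrCA mulfV ?mulr1// lt0r_neq0.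
have : 0 < n%:R * (e / 2) by rewrite mulr_gt0// divr_gt0.
lra.
Qed.

(** * Contact points of the symmetrized subgraph *)

(** Where [f] is positive, [psi] is finite and equals [- ln f], so convexity of [psi] can be read
    off in terms of [ln f]. *)
Lemma log_concave_expR (R : realType) d (f : 'rV[R]_d -> R) x y t :
  log_concave f -> 0 <= t -> t <= 1 -> 0 < f x -> 0 < f y ->
  expR (t * ln (f x) + (1 - t) * ln (f y)) <= f (t *: x + (1 - t) *: y).
Proof.
move=> [psi [psiNy psi_cvx fE]] t0 t1 fx0 fy0.
have psi_ln z : 0 < f z -> psi z = (- ln (f z))%:E.
  move=> fz; have := fE z; have := psiNy z.
  case: (psi z) => [r _ [->]|_ [fz0]|] //; first by rewrite expRK opprK.
  by rewrite fz0 ltxx in fz.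
have := psi_cvx x y t t0 t1; rewrite (psi_ln x)// (psi_ln y)// -!EFinM -EFinD.
move: (_ + _) (psiNy (t *: x + (1 - t) *: y)) (fE (t *: x + (1 - t) *: y)) => z.
case: (psi z) => [r _ [->]|//|//]; rewrite lee_fin ler_expR; lra.
Qed.

Lemma dot_hsubmx (R : realType) n m (u v : 'rV[R]_(n + m)) :
  dot u v = dot (lsubmx u) (lsubmx v) + dot (rsubmx u) (rsubmx v).
Proof. by rewrite -{1}[u]hsubmxK -{1}[v]hsubmxK dot_row_mx. Qed.

Lemma dot_rV1 (R : realType) (u v : 'rV[R]_1) : dot u v = u 0 0 * v 0 0.
Proof. by rewrite /dot big_ord1. Qed.

Section contact.
Context {R : realType} {d : nat} (f : 'rV[R]_d -> R).
Hypothesis f_lc : log_concave f.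
Hypothesis ball_sub : unit_ball R (d + 1) `<=` symmetrized_subgraph f.
Implicit Types (x y w : 'rV[R]_d) (u v : 'rV[R]_(d + 1)).

(** The upper point of the sphere over [w] lies in the subgraph; the bound is the logarithm of that
    fact. *)
Lemma ln_ge_of_ball w : dot w w < 1 ->
  0 < f w /\ ln 2 + ln (1 - dot w w) / 2 <= ln (f w).
Proof.
move=> w1; pose s := Num.sqrt (1 - dot w w).
have s0 : 0 < s by rewrite sqrtr_gt0 subr_gt0.
have ss : s * s = 1 - dot w w by rewrite -expr2 sqr_sqrtr// subr_ge0 ltW.
have : symmetrized_subgraph f (row_mx w s%:M).
  by apply: ball_sub; rewrite unit_ballE dot_row_mx dot_rV1 !mxE eqxx ss addrC subrK.
rewrite /symmetrized_subgraph /= row_mxKl row_mxKr mxE eqxx mulr1n gtr0_norm// => sf.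
have f2 : 2 * s <= f w by lra.
split; first by apply: lt_le_trans f2; rewrite mulr_gt0.
have lns : ln (1 - dot w w) = 2 * ln s.
  by rewrite -ss lnM ?posrE// mulr2n mulrDl mul1r.
rewrite lns mulrAC mulfV// mul1r -lnM ?posrE// ler_ln ?posrE ?mulr_gt0//.
by apply: lt_le_trans f2; rewrite mulr_gt0.
Qed.

(** If the minorant [g] exceeded the height of [v], by continuity it would do so nearby, and [v]
    would be interior to the subgraph. *)
Lemma boundary_subgraph_le v (g : 'rV[R]_d -> R) :
  boundary (symmetrized_subgraph f) v ->
  g y @[y --> lsubmx v] --> g (lsubmx v) ->
  (\forall y \near lsubmx v, g y <= f y / 2) ->
  g (lsubmx v) <= `|(rsubmx v : 'rV[R]_1) 0 0|.
Proof.
move=> [_ nint] cg gf; rewrite leNgt; apply/negP => lt; apply: nint.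
have cl : lsubmx y @[y --> v] --> lsubmx v.
  apply: (@cvg_rowP _ _ (nbhs v)) => i; rewrite mxE.
  by under eq_fun do rewrite mxE; exact: coord_continuous.
have cr : (rsubmx y : 'rV[R]_1) 0 0 @[y --> v] --> (rsubmx v : 'rV[R]_1) 0 0.
  by rewrite mxE; under eq_fun do rewrite mxE; exact: coord_continuous.
have cgl : g (lsubmx y) @[y --> v] --> g (lsubmx v).
  exact: (@cvg_comp _ _ _ (fun u : 'rV[R]_(d + 1) => lsubmx u) g _ _ _ cl cg).
have cn : `|(rsubmx y : 'rV[R]_1) 0 0| @[y --> v] --> `|(rsubmx v : 'rV[R]_1) 0 0|.
  exact: (@cvg_norm _ _ _ (nbhs v) _ _ _ cr).
have /cvgr_gt/(_ 0) : g (lsubmx y) - `|(rsubmx y : 'rV[R]_1) 0 0| @[y --> v] -->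
    g (lsubmx v) - `|(rsubmx v : 'rV[R]_1) 0 0|.
  exact: (@cvgB _ _ _ (nbhs v) _ _ _ _ _ cgl cn).
rewrite subr_gt0 => /(_ lt) pos.
have le : \forall y \near v, g (lsubmx y) <= f (lsubmx y) / 2 by exact: (cl _ gf).
move: pos le; apply: filterS2 => y; rewrite subr_gt0 => /ltW + gy.
by move=> /le_trans; exact.
Qed.

(* lsubmx v is the convex combination of y and the point w of the ball with
   weights l / (1 + l) and 1 / (1 + l). *)
Lemma boundary_subgraph_expR_le v y l :
  boundary (symmetrized_subgraph f) v -> 0 < f y -> 0 < l ->
  let w := lsubmx v - l *: (y - lsubmx v) in
  dot w w < 1 ->
  expR ((l * ln (f y / 2) + ln (1 - dot w w) / 2) / (1 + l)) <= `|(rsubmx v : 'rV[R]_1) 0 0|.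
Proof.
move=> bv fy0 l0 w w1.
(* Letting the ball point [W x] move with [x] keeps every nearby [x] a combination of [y] and [W x]
   with the same weights, so [g] is a continuous minorant of [f / 2]. *)
pose W x := x - l *: (y - x).
pose g x := expR ((l * ln (f y / 2) + ln (1 - dot (W x) (W x)) / 2) / (1 + l)).
have l1 : 0 < 1 + l by rewrite addr_gt0.
have cWW (F : set_system 'rV[R]_d) (FF : Filter F) x :
    z @[z --> F] --> x -> dot (W z) (W z) @[z --> F] --> dot (W x) (W x).
  move=> zx; suff cW : W z @[z --> F] --> W x by exact: cvg_dot.
  apply: cvgB => //; apply: cvgZ; first exact: cvg_cst.
  by apply: cvgB => //; exact: cvg_cst.
have cg (F : set_system 'rV[R]_d) (FF : Filter F) x :
    z @[z --> F] --> x -> dot (W x) (W x) < 1 -> g z @[z --> F] --> g x.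
  move=> zx Wx1; apply: (@cvg_comp _ _ _ _ (@expR R)); last exact: continuous_expR.
  apply: cvgM; last exact: cvg_cst.
  apply: cvgD; first exact: cvg_cst.
  apply: cvgM; last exact: cvg_cst.
  apply: (@cvg_comp _ _ _ _ (@ln R)); last by apply: continuous_ln; rewrite subr_gt0.
  by apply: cvgB; [exact: cvg_cst|exact: cWW].
have xx : z @[z --> lsubmx v] --> lsubmx v by exact: cvg_id.
have nF := nbhs_filter (lsubmx v).
apply: (boundary_subgraph_le (g := g)) => //; first exact: (cg _ _ _ xx w1).
apply: filterS (cvgr_lt _ (cWW _ _ _ xx) _ w1) => x Wx1.
have [fW0 fW] := ln_ge_of_ball Wx1.
pose t := l / (1 + l).
have t1 : 1 - t = (1 + l)^-1 by rewrite /t; field; exact: lt0r_neq0.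
have xE : x = t *: y + (1 - t) *: W x.
  have -> : W x = (1 + l) *: x - l *: y.
    by rewrite /W scalerBr opprB scalerDl scale1r addrA.
  rewrite t1 scalerBr !scalerA mulVf ?lt0r_neq0// scale1r.
  by rewrite [_^-1 * l]mulrC addrC subrK.
rewrite ler_pdivlMr// [X in f X]xE.
apply: le_trans (log_concave_expR f_lc _ _ fy0 fW0); last 2 first.
- by rewrite divr_ge0// ltW.
- by rewrite -subr_ge0 t1 invr_ge0 ltW.
rewrite -[X in _ * X](@lnK R 2) ?posrE// -expRD ler_expR t1 ln_div ?posrE//.
have -> : t = l / (1 + l) by [].
rewrite -subr_ge0.
have -> : l / (1 + l) * ln (f y) + (1 + l)^-1 * ln (f (W x)) -
    ((l * (ln (f y) - ln 2) + ln (1 - dot (W x) (W x)) / 2) / (1 + l) + ln 2) =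
    (ln (f (W x)) - (ln 2 + ln (1 - dot (W x) (W x)) / 2)) / (1 + l).
  by field; exact: lt0r_neq0.
by rewrite divr_ge0 ?subr_ge0// ltW.
Qed.

(** First-order part, as [l -> 0], of [boundary_subgraph_expR_le]: [f / 2] lies below the
    exponential tangent to the sphere at the contact point. *)
Lemma contact_ln_le v y s : boundary (symmetrized_subgraph f) v -> dot v v = 1 ->
  0 < f y -> `|(rsubmx v : 'rV[R]_1) 0 0| = s -> 0 < s ->
  s ^+ 2 * ln (f y / 2 / s) <= - dot (lsubmx v) (y - lsubmx v).
Proof.
move=> bv vv fy0 sE s0; set x := lsubmx v.
have xx : dot x x = 1 - s ^+ 2.
  by rewrite -vv dot_hsubmx dot_rV1 -expr2 -sE real_normK ?num_real// addrK.
pose p := dot x (y - x); pose r := dot (y - x) (y - x); pose A := ln (f y / 2 / s).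
have r0 : 0 <= r by exact: dot_ge0.
have lnA : ln (f y / 2) = A + ln s.
  by rewrite /A [in RHS]ln_div ?posrE ?divr_gt0// subrK.
suff : s ^+ 2 * A + p <= 0 by move=> h; rewrite -subr_le0 opprK.
have den0 : 0 < 2 * `|p| + r + 1 by have := normr_ge0 p; lra.
(* For [l < e] the quantity [D], which equals [1 - dot w w], stays positive; the bound by 1 gives
   [l ^+ 2 <= l]. *)
pose e := Num.min 1 (s ^+ 2 / (2 * `|p| + r + 1)).
have e0 : 0 < e by rewrite lt_min ltr01 divr_gt0// exprn_gt0.
apply: (@le0_of_small _ _ (r / 2 + `|2 * p * A| + `|r * A|) e) => // l l0.
rewrite lt_min => /andP[l1]; rewrite ltr_pdivlMr// => ls.
pose D := s ^+ 2 + 2 * l * p - l ^+ 2 * r.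
have lp : - (l * `|p|) <= l * p <= l * `|p| by rewrite -ler_norml normrM (gtr0_norm l0).
have llr : l ^+ 2 * r <= l * r.
  by rewrite ler_wpM2r// expr2 ler_piMl// ltW.
have D0 : 0 < D by rewrite /D; lra.
pose w := x - l *: (y - x).
have ww : 1 - dot w w = D.
  rewrite /D /w /p /r; move: (y - x) => z.
  by rewrite !(dotDl, dotDr, dotNl, dotNr, dotZl, dotZr) xx (dotC z x); ring.
have w1 : dot w w < 1 by rewrite -subr_gt0 ww.
have := boundary_subgraph_expR_le bv fy0 l0 w1.
rewrite sE -[X in _ <= X](@lnK R s) ?posrE// ler_expR ler_pdivrMr ?addr_gt0//.
rewrite -/x -/w ww lnA => main.
(* Bounding [ln (D / s ^+ 2)] below by [1 - s ^+ 2 / D] and clearing [D] leaves a polynomial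
   inequality, whose limit as [l -> 0] is the claim. *)
have := @ln_ge_1subV R (D / s ^+ 2); rewrite divr_gt0 ?exprn_gt0// => /(_ isT).
rewrite ln_div ?posrE ?exprn_gt0// lnXn// invf_div => lnD.
have {main lnD} : 2 * l * A <= s ^+ 2 / D - 1 by lra.
rewrite -(ler_pM2r D0) mulrBl mul1r divfK ?lt0r_neq0// => main.
have {main} : l * (2 * A * D) <= l * (l * r - 2 * p) by rewrite /D in main *; lra.
rewrite ler_pM2l// => main.
have n1 := ler_norm (- (2 * p * A)); rewrite normrN in n1.
have n2 := ler_norm (r * A).
have n3 : l * (- (2 * p * A)) <= l * `|2 * p * A| by rewrite ler_pM2l.
have n4 : l ^+ 2 * (r * A) <= l * `|r * A|.
  apply: (@le_trans _ _ (l ^+ 2 * `|r * A|)); first by rewrite ler_pM2l// exprn_gt0.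
  by rewrite ler_wpM2r// expr2 ler_piMl// ltW.
by rewrite /D in main; lra.
Qed.

(** Otherwise, stepping from [x] away from [y] enters the open ball, and log-concavity forces a
    positive height at [v]. *)
Lemma contact_dot_le1 v y : boundary (symmetrized_subgraph f) v -> dot v v = 1 ->
  0 < f y -> (rsubmx v : 'rV[R]_1) 0 0 = 0 -> dot (lsubmx v) y <= 1.
Proof.
move=> bv vv fy0 xi0; set x := lsubmx v.
have xx : dot x x = 1 by rewrite -vv [RHS]dot_hsubmx dot_rV1 xi0 mul0r addr0.
rewrite leNgt; apply/negP => xy.
pose p := dot x (y - x); pose r := dot (y - x) (y - x).
have p0 : 0 < p by rewrite /p dotDr dotNr xx subr_gt0.
have r0 : 0 <= r by exact: dot_ge0.
(* Chosen so that [l * r <= p], which makes the squared norm [1 + l * (l * r - 2 * p)] less than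
   1. *)
pose l := p / (r + 1).
have r1 : 0 < r + 1 by rewrite ltr_wpDl.
have l0 : 0 < l by rewrite divr_gt0.
have lr : l * r <= p by rewrite -mulrA ler_piMr ?ltW// mulrC ltr_pdivrMr// mul1r ltrDl.
pose w := x - l *: (y - x).
have ww : dot w w = 1 + l * (l * r - 2 * p).
  rewrite /w /p /r; move: (y - x) => z.
  by rewrite !(dotDl, dotDr, dotNl, dotNr, dotZl, dotZr) xx (dotC z x); ring.
have w1 : dot w w < 1 by rewrite ww gtrDl pmulr_rlt0//; lra.
have := boundary_subgraph_expR_le bv fy0 l0 w1.
by rewrite xi0 normr0 leNgt expR_gt0.
Qed.

End contact.

(** * Contact inequalities for an ellipsoid inside the subgraph *)

Section ellipsoid_in_subgraph.
Context {R : realType} {d : nat} (f : 'rV[R]_d -> R).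
Hypothesis f_lc : log_concave f.
Hypothesis ball_sub : unit_ball R (d + 1) `<=` symmetrized_subgraph f.
Variables (A : 'M[R]_d) (alpha b : 'rV[R]_d) (t beta : R).
Hypothesis t0 : 0 < t.
Hypothesis subgraph : forall x s, dot x x + s ^+ 2 <= 1 ->
  `|dot x alpha + t * s + beta| <= f (x *m A + b) / 2.
Implicit Types (x z h : 'rV[R]_d) (v : 'rV[R]_(d + 1)).

(** The ball contains both [(x, s)] and [(x, - s)]; the sign is chosen so that [t * s] adds to the
    shear term in absolute value. *)
Lemma subgraph_norm_le x s : 0 <= s -> dot x x + s ^+ 2 <= 1 ->
  `|dot x alpha + beta| + t * s <= f (x *m A + b) / 2.
Proof.
move=> s0 xs; have ts : 0 <= t * s by rewrite mulr_ge0// ltW.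
have [q0|q0] := leP 0 (dot x alpha + beta).
  apply: le_trans (subgraph xs); rewrite (ger0_norm q0).
  by rewrite [dot x alpha + t * s + beta]addrAC ger0_norm// addr_ge0.
have /subgraph : dot x x + (- s) ^+ 2 <= 1 by rewrite sqrrN.
apply: le_trans; rewrite (ltr0_norm q0) mulrN.
by rewrite [_ - _ + beta]addrAC ler0_norm; lra.
Qed.

Lemma subgraph_gt0 x s : 0 < s -> dot x x + s ^+ 2 <= 1 -> 0 < f (x *m A + b).
Proof.
move=> s0 xs; have := subgraph_norm_le (ltW s0) xs.
have := normr_ge0 (dot x alpha + beta); have : 0 < t * s by rewrite mulr_gt0.
lra.
Qed.

Section contact_point.
Variable v : 'rV[R]_(d + 1).
Hypothesis bv : boundary (symmetrized_subgraph f) v.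
Hypothesis vv : dot v v = 1.
Let x := lsubmx v.
Let s := `|(rsubmx v : 'rV[R]_1) 0 0|.

Lemma contact_split : dot x x + s ^+ 2 = 1.
Proof. by rewrite -vv [RHS]dot_hsubmx dot_rV1 -expr2 real_normK ?num_real. Qed.

(** The tangent bound [contact_ln_le] is taken at the image of the contact point, where
    [subgraph_norm_le] bounds [f] from below. *)
Lemma contact_ln_dot_le : 0 < s ->
  s ^+ 2 * ln (t + `|dot x alpha + beta| / s) + dot x (x *m A + b) <= dot x x.
Proof.
move=> s0; have xs : dot x x + s ^+ 2 <= 1 by rewrite contact_split.
have fy := subgraph_gt0 s0 xs.
have := contact_ln_le f_lc ball_sub bv vv fy erefl s0; rewrite -/x -/s dotDr dotNr.
suff : s ^+ 2 * ln (t + `|dot x alpha + beta| / s) <=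
    s ^+ 2 * ln (f (x *m A + b) / 2 / s) by lra.
have q0 : 0 <= `|dot x alpha + beta| / s by rewrite divr_ge0// ltW.
have tq : 0 < t + `|dot x alpha + beta| / s by exact: ltr_wpDr q0 t0.
have fys : 0 < f (x *m A + b) / 2 / s by rewrite !divr_gt0.
rewrite ler_pM2l ?exprn_gt0// ler_ln ?posrE//.
rewrite ler_pdivlMr// mulrDl divfK ?lt0r_neq0// addrC.
exact: subgraph_norm_le (ltW s0) xs.
Qed.

(** Shrinking [z] by [1 - e] leaves room for height [e], so [f] is positive at the image and
    [contact_dot_le1] applies; then [e -> 0]. *)
Lemma contact_dot_le z : s = 0 -> dot z z <= 1 -> dot x (z *m A + b) <= 1.
Proof.
move=> s0 z1; rewrite -subr_le0.
apply: (@le0_of_small _ _ (dot x (z *m A)) 1) => // e e0 e1.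
suff : dot x (((1 - e) *: z) *m A + b) <= 1.
  by rewrite -scalemxAl !dotDr dotZr; lra.
apply: (contact_dot_le1 f_lc ball_sub bv vv); last exact: normr0_eq0.
apply: (@subgraph_gt0 _ e) => //; rewrite dotZl dotZr.
have : (1 - e) * ((1 - e) * dot z z) <= (1 - e) * (1 - e).
  by rewrite ler_wpM2l ?ler_piMr//; lra.
suff : (1 - e) * (1 - e) + e ^+ 2 <= 1 by lra.
have : e * e <= e by rewrite ler_piMl// ltW.
by rewrite expr2; lra.
Qed.

(** Common form of the bounds for [s = 0] and [s > 0], with the shear term dropped, ready to be
    summed with the weights. *)
Lemma contact_ln_scale_le : s ^+ 2 * ln t + dot x (x *m A + b) <= dot x x.
Proof.
have := normr_ge0 ((rsubmx v : 'rV[R]_1) 0 0); rewrite -/s le_eqVlt => /orP[/eqP s0|s0].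
  have xx : dot x x = 1 by rewrite -contact_split -s0 expr0n addr0.
  by rewrite -s0 expr0n mul0r add0r xx contact_dot_le ?xx.
apply: le_trans (contact_ln_dot_le s0); rewrite lerD2r ler_pM2l ?exprn_gt0//.
have q0 : 0 <= `|dot x alpha + beta| / s by rewrite divr_ge0// ltW.
by rewrite ler_ln ?posrE// ?lerDl//; exact: ltr_wpDr q0 t0.
Qed.

(* The points of the ellipsoid over [x + e h] lie, to first order in [e], on
   the correct side of the tangent of the exponential hypograph at [v]. *)
Lemma contact_tangent_le (eps : R) h : `|eps| = 1 ->
  0 < s -> t = 1 -> dot x (x *m A + b) = dot x x -> dot x alpha + beta = 0 ->
  eps * s * dot h alpha + dot x (h *m A) <= dot x h.
Proof.
move=> eps1 s0 t1 Ax q0; apply/ler_addgt0Pr => D D0.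
(* The height is lowered at rate [k], slightly faster than the sphere descends in direction [h]; the
   surplus [D] absorbs second-order terms. *)
pose k := (dot x h + D) / s.
have sk : s * k = dot x h + D by rewrite /k mulrC divfK// lt0r_neq0.
pose p1 := dot x (h *m A); pose q1 := eps * dot h alpha.
suff : s * (s * (q1 - k) + p1) <= 0.
  by rewrite pmulr_rle0// mulrBr sk /p1 /q1 mulrA [s * eps]mulrC; lra.
(* The three bounds keep, in order, [s - e * k] positive, [s ^+ 2 + e * p1] positive, and the
   displaced point in the ball. *)
pose e1 := Num.min (s / (`|k| + 1)) (Num.min (s ^+ 2 / (`|p1| + 1))
  (2 * D / (dot h h + k ^+ 2 + 1))).
have k0 : 0 < `|k| + 1 by rewrite ltr_wpDl.
have p0 : 0 < `|p1| + 1 by rewrite ltr_wpDl.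
have h0 : 0 < dot h h + k ^+ 2 + 1.
  by rewrite ltr_wpDl// addr_ge0 ?dot_ge0// sqr_ge0.
have e10 : 0 < e1 by rewrite !lt_min !divr_gt0// ?exprn_gt0// mulr_gt0.
apply: (@le0_of_small _ _ (p1 * (k - q1)) e1) => // e e0.
rewrite !lt_min !ltr_pdivlMr// => /and3P[ek ep eh].
have nk : e * k <= e * `|k| by rewrite ler_pM2l// ler_norm.
have np : - (e * p1) <= e * `|p1|.
  by rewrite -mulrN ler_pM2l// -normrN ler_norm.
have s'0 : 0 < s - e * k by lra.
have z1 : dot (x + e *: h) (x + e *: h) + (s - e * k) ^+ 2 <= 1.
  rewrite -contact_split !(dotDl, dotDr, dotZl, dotZr) (dotC h x).
  have : e * (e * (dot h h + k ^+ 2) - 2 * D) <= 0 by rewrite pmulr_rle0//; lra.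
  have : 2 * e * (s * k) = 2 * e * (dot x h + D) by rewrite sk.
  lra.
have fY0 := subgraph_gt0 s'0 z1.
have := subgraph_norm_le (ltW s'0) z1.
have -> : dot (x + e *: h) alpha + beta = e * dot h alpha.
  by rewrite dotDl dotZl addrAC q0 add0r.
have := contact_ln_le f_lc ball_sub bv vv fY0 erefl s0; rewrite -/x -/s.
have -> : dot x ((x + e *: h) *m A + b - x) = e * p1.
  rewrite mulmxDl -scalemxAl !(dotDr, dotZr, dotNr); move: Ax; rewrite dotDr /p1; lra.
rewrite t1 mul1r => lnY normY.
have epsq : e * q1 <= `|e * dot h alpha|.
  by rewrite /q1 mulrCA (le_trans (ler_norm _))// normrM eps1 mul1r.
set F := f _ in fY0 lnY normY; set X := F / 2 / s in lnY.
have X0 : 0 < X by rewrite !divr_gt0.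
have FX : F / 2 = X * s by rewrite /X divfK// lt0r_neq0.
have lnX := ln_ge_1subV X0.
have : s ^+ 2 * (1 - X^-1) <= - (e * p1).
  by apply: le_trans lnY; rewrite ler_pM2l ?exprn_gt0.
rewrite -(ler_pM2r X0) -mulrA mulrBl mul1r mulVf ?lt0r_neq0// => XP.
have : (s ^+ 2 + e * p1) * (s * X) <= s * s ^+ 2.
  by rewrite mulrCA ler_pM2l//; lra.
have : (s ^+ 2 + e * p1) * (s - e * k + e * q1) <= (s ^+ 2 + e * p1) * (s * X).
  by rewrite ler_pM2l; lra.
move=> /le_trans/[apply] main.
have : e * (s * (s * (q1 - k) + p1)) <= e * (e * (p1 * (k - q1))) by lra.
by rewrite ler_pM2l.
Qed.

(** The inequality holds for both signs of [eps] and for [h] and [- h], so it splits into two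
    equations. *)
Lemma contact_tangent h :
  0 < s -> t = 1 -> dot x (x *m A + b) = dot x x -> dot x alpha + beta = 0 ->
  dot h alpha = 0 /\ dot x (h *m A) = dot x h.
Proof.
move=> s0 t1 Ax q0.
have H1 := @contact_tangent_le 1 h (normr1 _) s0 t1 Ax q0.
have H2 := @contact_tangent_le (-1) h (normrN1 _) s0 t1 Ax q0.
have H3 := @contact_tangent_le 1 (- h) (normr1 _) s0 t1 Ax q0.
have H4 := @contact_tangent_le (-1) (- h) (normrN1 _) s0 t1 Ax q0.
rewrite !(mulNmx, dotNl, dotNr) in H3 H4.
suff sa : s * dot h alpha = 0.
  split; first by apply/eqP; move/eqP: sa; rewrite mulf_eq0 gt_eqF.
  by lra.
by lra.
Qed.

(** On the unit ball the functional [dot w] is maximal at the unit vector [x]; equality in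
    Cauchy-Schwarz makes [w] a multiple of [x]. *)
Lemma contact_eigenvector : s = 0 -> dot x (x *m A + b) = dot x x ->
  x *m A^T = dot x (x *m A) *: x.
Proof.
move=> s0 Ax.
have xx : dot x x = 1 by rewrite -contact_split s0 expr0n addr0.
set w := x *m A^T; set l := dot x (x *m A).
have wz z : dot w z = dot x (z *m A) by rewrite [RHS]dotC dot_mulmx dotC.
have max z : dot z z <= 1 -> dot w z <= l.
  move=> /(contact_dot_le s0); rewrite dotDr -wz.
  by move: Ax; rewrite xx dotDr -/l; lra.
have wl : dot w w <= l ^+ 2.
  pose n := Num.sqrt (dot w w).
  have nn : n * n = dot w w by rewrite -expr2 sqr_sqrtr// dot_ge0.
  have [n0|n0] := eqVneq n 0; first by rewrite -nn n0 mul0r sqr_ge0.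
  have n_gt0 : 0 < n by rewrite lt_neqAle eq_sym n0 sqrtr_ge0.
  have := max (n^-1 *: w); rewrite !(dotZl, dotZr) -nn mulKf// mulVf// lexx => /(_ isT) nl.
  have l0 := le_trans (ltW n_gt0) nl.
  by rewrite -expr2 ler_pXn2r ?nnegrE// ltW.
have wx : dot w x = l by rewrite wz.
apply/eqP; rewrite -subr_eq0 -dot_eq0 eq_le dot_ge0 andbT.
rewrite !(dotDl, dotDr, dotNl, dotNr, dotZl, dotZr) xx (dotC x w) wx.
by move: wl; rewrite expr2; lra.
Qed.

End contact_point.

End ellipsoid_in_subgraph.

(** * Optimality of the ball *)

Lemma ln_eq_subr1 (R : realType) (x : R) : 0 < x -> ln x = x - 1 -> x = 1.
Proof.
move=> x0 lnx; apply/eqP; rewrite -subr_eq0; apply/negPn/negP => /expR_gt1Dx.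
by rewrite -lnx lnK ?posrE// lnx addrC subrK ltxx.
Qed.

Section john_decomposition.
Context {R : realType} {k : nat}.

(** Multiply the decomposition of the identity by [M] and take traces. *)
Lemma sum_form_trace n (u : 'I_k -> 'rV[R]_n) (c : 'I_k -> R) (M : 'M[R]_n) :
  \sum_i c i *: ((u i)^T *m u i) = 1%:M ->
  \sum_i c i * dot (u i *m M) (u i) = \tr M.
Proof.
move=> I1; rewrite -[M in RHS]mulmx1 -I1 mulmx_sumr linear_sum; apply: eq_bigr => i _ /=.
rewrite -scalemxAr linearZ/=; congr (_ * _).
by rewrite mulmxA mxtrace_mulC mulmxA dot_mxE /mxtrace big_ord1.
Qed.

Lemma identity_lsubmx d (u : 'I_k -> 'rV[R]_(d + 1)) (c : 'I_k -> R) :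
  \sum_i c i *: ((u i)^T *m u i) = 1%:M ->
  \sum_i c i *: ((lsubmx (u i))^T *m lsubmx (u i)) = 1%:M.
Proof.
move=> I1; apply/matrixP => i j.
have := congr1 (fun M : 'M[R]_(d + 1) => M (lshift 1 i) (lshift 1 j)) I1.
rewrite /= !summxE !mxE eq_lshift => <-; apply: eq_bigr => l _.
by rewrite !mxE !big_ord1 !mxE.
Qed.

End john_decomposition.

(** * The determinant bound and its equality case *)

Section john_inequality.
Context {R : realType} {d : nat} (f : 'rV[R]_d -> R).
Hypothesis f_lc : log_concave f.
Hypothesis ball_sub : unit_ball R (d + 1) `<=` symmetrized_subgraph f.
Context {k : nat} (u : 'I_k -> 'rV[R]_(d + 1)) (c : 'I_k -> R).
Hypothesis contact : forall i,
  (boundary (unit_ball R (d + 1)) `&` boundary (symmetrized_subgraph f)) (u i).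
Hypothesis c0 : forall i, 0 < c i.
Hypothesis identity : \sum_(i < k) c i *: ((u i)^T *m u i) = 1%:M.
Hypothesis centered : \sum_(i < k) c i *: (lsubmx (u i) : 'rV[R]_d) = 0.
Variables (T : 'M[R]_(d + 1)) (b : 'rV[R]_(d + 1)).
Hypothesis upT : upper_triangular T.
Hypothesis T0 : forall i, 0 < T i i.
Hypothesis sub :
  [set x *m T + b | x in unit_ball R (d + 1)] `<=` symmetrized_subgraph f.

Let A := ulsubmx T.
Let alpha := (ursubmx T)^T.
Let t := T (rshift d 0) (rshift d 0).
Let b' := lsubmx b.
Let beta := (rsubmx b : 'rV[R]_1) 0 0.
Let X i := lsubmx (u i).
Let S i := `|(rsubmx (u i) : 'rV[R]_1) 0 0|.

Let t0 : 0 < t. Proof. exact: T0. Qed.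

Let A0 i : 0 < A i i. Proof. by rewrite /A !mxE; exact: T0. Qed.

Let bu i : boundary (symmetrized_subgraph f) (u i).
Proof. by have [] := contact i. Qed.

Let uu i : dot (u i) (u i) = 1.
Proof. by have [/boundary_unit_ball] := contact i. Qed.

(** Triangularity makes the base point of an image independent of the height coordinate. *)
Let TE : T = block_mx A alpha^T 0 t%:M.
Proof.
rewrite -[LHS]submxK trmxK; congr block_mx.
  apply/matrixP => i j; rewrite !mxE; apply: upT => /=.
  by rewrite (leq_trans (ltn_ord j))// leq_addr.
by rewrite [LHS]mx11_scalar !mxE.
Qed.

Let subgraph x s : dot x x + s ^+ 2 <= 1 ->
  `|dot x alpha + t * s + beta| <= f (x *m A + b') / 2.
Proof.
move=> xs; have : symmetrized_subgraph f (row_mx x s%:M *m T + b).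
  by apply: sub; exists (row_mx x s%:M) => //;
     rewrite unit_ballE dot_row_mx dot_rV1 !mxE eqxx mulr1n -expr2.
rewrite /symmetrized_subgraph /= TE mul_row_block mulmx0 addr0 -[b]hsubmxK add_row_mx.
rewrite row_mxKl row_mxKr -/b' -scalar_mxM.
rewrite mxE [X in `|X + _|]mxE -dot_mxE -/beta.
by have -> : ((s * t)%:M : 'M[R]_1) 0 0 = t * s by rewrite mxE mulr1n mulrC.
Qed.

Let form_trace M : \sum_i c i * dot (X i *m M) (X i) = \tr M.
Proof. exact/sum_form_trace/identity_lsubmx. Qed.

Let sum_norm : \sum_i c i * dot (X i) (X i) = d%:R.
Proof.
rewrite -(mxtrace1 R d) -form_trace; apply: eq_bigr => i _.
by rewrite mulmx1.
Qed.

(** The identity has trace [d + 1] and its block on the base space has trace [d]; the heights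
    account for the difference. *)
Let sum_height : \sum_i c i * S i ^+ 2 = 1.
Proof.
have : \sum_i c i * dot (u i) (u i) = (d + 1)%:R.
  rewrite -(mxtrace1 R (d + 1)) -(sum_form_trace _ identity).
  by apply: eq_bigr => i _; rewrite mulmx1.
have -> : \sum_i c i * dot (u i) (u i) =
    \sum_i c i * dot (X i) (X i) + \sum_i c i * S i ^+ 2.
  rewrite -big_split; apply: eq_bigr => i _ /=.
  by rewrite -mulrDr contact_split uu.
rewrite sum_norm natrD; exact: addrI.
Qed.

Let sum_shift : \sum_i c i * dot (X i) b' = 0.
Proof.
have : dot (\sum_i c i *: X i) b' = 0 by rewrite /X centered dot0l.
by rewrite dot_suml => E; rewrite -[RHS]E; apply: eq_bigr => i _; rewrite dotZl.
Qed.

Let sum_image : \sum_i c i * dot (X i) (X i *m A + b') = \tr A.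
Proof.
have <- : \sum_i c i * dot (X i *m A) (X i) + \sum_i c i * dot (X i) b' = \tr A.
  by rewrite form_trace sum_shift addr0.
rewrite -big_split; apply: eq_bigr => i _ /=.
by rewrite -mulrDr dotDr (dotC (X i) (_ *m _)).
Qed.

Let ln_trace_le : ln t + \tr A <= d%:R.
Proof.
rewrite -sum_norm -sum_image.
have <- : \sum_i c i * S i ^+ 2 * ln t = ln t by rewrite -mulr_suml sum_height mul1r.
rewrite -big_split/=; apply: ler_sum => i _; rewrite -mulrA -mulrDr ler_pM2l//.
exact: (contact_ln_scale_le f_lc ball_sub t0 subgraph).
Qed.

Let prod_diag : \prod_i T i i = expR (\sum_i ln (A i i) + ln t).
Proof.
rewrite prod_expR_ln// big_split_ord/= big_ord1; congr (expR (_ + _)).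
by apply: eq_bigr => i _; rewrite /A !mxE.
Qed.

Let sum_ln_le : \sum_i ln (A i i) <= \tr A - d%:R.
Proof.
have -> : \tr A - d%:R = \sum_i (A i i - 1).
  by rewrite sumrB sumr_const card_ord.
by apply: ler_sum => i _; exact: ln_le_subr1.
Qed.

Lemma prod_diag_le1 : \prod_i T i i <= 1.
Proof. by rewrite prod_diag expR_le1; have := sum_ln_le; have := ln_trace_le; lra. Qed.

Section equality.
Hypothesis prod1 : \prod_i T i i = 1.

Let sum_ln : \sum_i ln (A i i) + ln t = 0.
Proof. by apply: expR_inj; rewrite -prod_diag prod1 expR0. Qed.

(** Equality in the determinant bound forces equality in each [ln a <= a - 1]. *)
Let Aii i : A i i = 1.
Proof.
have h j : true -> 0 <= A j j - 1 - ln (A j j).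
  by move=> _; rewrite subr_ge0; exact: ln_le_subr1.
have sum0 : \sum_i (A i i - 1 - ln (A i i)) = 0.
  apply/eqP; rewrite eq_le sumr_ge0 ?andbT// !sumrB sumr_const card_ord.
  by have := sum_ln; have := ln_trace_le; rewrite /mxtrace; lra.
apply: ln_eq_subr1 => //; apply/esym/eqP; rewrite -subr_eq0; apply/eqP.
exact: (psumr_eq0P h sum0).
Qed.

Let t1 : t = 1.
Proof.
apply/eqP; rewrite -ln_eq0//; have := sum_ln.
by rewrite big1 ?add0r => [->|i _]; rewrite // Aii ln1.
Qed.

Let trA : \tr A = d%:R.
Proof. by rewrite /mxtrace (eq_bigr _ (fun i _ => Aii i)) sumr_const card_ord. Qed.

(** As [\tr A = d], the nonnegative slacks of the contact inequalities have weighted sum zero, so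
    each of them vanishes. *)
Let image_eq i : dot (X i) (X i *m A + b') = dot (X i) (X i).
Proof.
have h j : true -> 0 <= c j * (dot (X j) (X j) - dot (X j) (X j *m A + b')).
  move=> _; rewrite pmulr_rge0// subr_ge0.
  have := contact_ln_scale_le f_lc ball_sub t0 subgraph (bu j) (uu j).
  by rewrite t1 ln1 mulr0 add0r.
have sum0 : \sum_j c j * (dot (X j) (X j) - dot (X j) (X j *m A + b')) = 0.
  by under eq_bigr do rewrite mulrBr; rewrite sumrB sum_norm sum_image trA subrr.
have /eqP := psumr_eq0P h sum0 (i := i) isT.
by rewrite mulf_eq0 gt_eqF//= subr_eq0 => /eqP.
Qed.

(** With [t = 1] and equality of the dot products, [contact_ln_dot_le] reduces to
    [ln (1 + q / S i) <= 0]. *)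
Let shear_eq0 i : 0 < S i -> dot (X i) alpha + beta = 0.
Proof.
move=> S0; have := contact_ln_dot_le f_lc ball_sub t0 subgraph (bu i) (uu i) S0.
rewrite -/(X i) -/(S i) image_eq -lerBrDr subrr pmulr_rle0 ?exprn_gt0// t1.
set q := `|dot (X i) alpha + beta|.
have q0 : 0 <= q / S i by rewrite divr_ge0 ?normr_ge0 ?(ltW S0).
rewrite -[X in _ <= X]ln1 ler_ln ?posrE ?ltr01 ?ltr_wpDr//.
rewrite gerDl pmulr_lle0 ?invr_gt0// normr_le0 => /eqP.
exact.
Qed.

Let eigenvector i : exists l, X i *m A^T = l *: X i.
Proof.
have := normr_ge0 ((rsubmx (u i) : 'rV[R]_1) 0 0); rewrite le_eqVlt => /orP[/eqP S0|S0].
  exists (dot (X i) (X i *m A)).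
  exact: (contact_eigenvector f_lc ball_sub t0 subgraph (bu i) (uu i) (esym S0) (image_eq i)).
exists 1; rewrite scale1r; apply/eqP; rewrite -subr_eq0 -dot_eq0; apply/eqP.
(* The tangent equation is applied in the direction of the defect [h] itself, which shows
   [dot h h = 0]. *)
set h := _ - _; rewrite {1}/h dotDl dotNl.
rewrite dot_mulmx trmxK.
have [_ ->] := contact_tangent f_lc ball_sub t0 subgraph (bu i) (uu i) h S0 t1
  (image_eq i) (shear_eq0 S0).
exact: subrr.
Qed.

(* By the eigenvector equations, A^T is a weighted sum of the symmetric matrices
   x^T x over the contact points. *)
Let A1 : A = 1%:M.
Proof.
have [l lE] := choice eigenvector.
have AT : A^T = \sum_i (c i * l i) *: ((X i)^T *m X i).
  rewrite -[LHS]mul1mx -(identity_lsubmx identity) mulmx_suml; apply: eq_bigr => i _.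
  by rewrite -scalemxAl -mulmxA lE -scalemxAr scalerA.
have Asym : A^T = A.
  rewrite -[RHS]trmxK AT linear_sum; apply: eq_bigr => i _ /=.
  by rewrite linearZ/= trmx_mul trmxK.
have upA (i j : 'I_d) : (j < i)%N -> A i j = 0 by move=> ji; rewrite /A !mxE; exact: upT.
apply/matrixP => i j; rewrite [RHS]mxE.
have [ij|ij|/val_inj ->] := ltngtP i j.
- by rewrite -Asym mxE upA// lt_eqF.
- by rewrite upA// gt_eqF.
- by rewrite eqxx Aii.
Qed.

(** With [A = 1%:M], [image_eq] makes [b'] orthogonal to every [X i], and these resolve the
    identity. *)
Let b'0 : b' = 0.
Proof.
rewrite -[LHS]mulmx1 -(identity_lsubmx identity) mulmx_sumr big1// => i _.
rewrite -scalemxAr mulmxA [b' *m _]mx11_scalar -dot_mxE mul_scalar_mx.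
have := image_eq i; rewrite A1 mulmx1 dotDr => /(canRL (addKr _)).
by rewrite addNr dotC => ->; rewrite scale0r scaler0.
Qed.

Let S_gt0 : exists i, 0 < S i.
Proof.
apply: contrapT => /forallNP S0; have := sum_height; rewrite big1 => [/esym/eqP|i _].
  by rewrite oner_eq0.
have := S0 i; move/negP; rewrite -leNgt normr_le0 => /eqP xi0.
by rewrite /S xi0 normr0 expr0n mulr0.
Qed.

(** At a contact point of positive height, the tangent equation in direction [alpha] gives
    [dot alpha alpha = 0]; then [shear_eq0] removes [beta]. *)
Lemma prod_diag_eq1_unit_ball : T = 1%:M /\ b = 0.
Proof.
have [i Si] := S_gt0.
have [aa _] := contact_tangent f_lc ball_sub t0 subgraph (bu i) (uu i) alpha Si t1
  (image_eq i) (shear_eq0 Si).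
have a0 : alpha = 0 by apply/eqP; rewrite -dot_eq0 aa.
have beta0 : beta = 0 by have := shear_eq0 Si; rewrite a0 dot0r add0r.
split; first by rewrite TE A1 a0 t1 trmx0 -scalar_mx_block.
rewrite -[LHS]hsubmxK -/b' b'0 [rsubmx b]mx11_scalar -/beta beta0.
by rewrite raddf0 row_mx0.
Qed.

End equality.

End john_inequality.

Theorem theorem1p1 (R : realType) (d : nat) (f : 'rV[R]_d -> R)
  (f_ge0 : forall x, 0 <= f x)
  (f_usc : upper_semicontinuous f)
  (f_lc : log_concave f)
  (f_int_gt0 : (0 < lebesgue_integral_rV f)%E)
  (f_int_fin : (lebesgue_integral_rV f < +oo)%E)
  (ball_sub : unit_ball R (d + 1) `<=` symmetrized_subgraph f) :
  unique_max_volume_ellipsoid (symmetrized_subgraph f) (unit_ball R (d + 1))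
  <->
  exists (k : nat) (u : 'I_k -> 'rV[R]_(d + 1)) (c : 'I_k -> R),
    [/\ forall i, (boundary (unit_ball R (d + 1)) `&`
                   boundary (symmetrized_subgraph f)) (u i),
        forall i, 0 < c i,
        \sum_(i < k) c i *: ((u i)^T *m u i) = 1%:M &
        \sum_(i < k) c i *: (lsubmx (u i) : 'rV[R]_d) = 0].
Proof.
split=> [[maxB _]|[k [u [c [contact c0 identity centered]]]]].
  exact: john_decomposition_of_max_volume.
set K := symmetrized_subgraph f; set B := unit_ball R (d + 1).
have volB : (0 < volume B)%E by exact: volume_unit_ball_gt0.
have volBfin : volume B \is a fin_num.
  by rewrite ge0_fin_numE ?ltW//; exact: volume_unit_ball_fin.
split; first split=> //.
- exists 1%:M, 0; split; first exact: unitmx1.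
  apply/seteqP; split=> [x Bx|_ [x Bx <-]]; last by rewrite mulmx1 addr0.
  by exists x => //; rewrite mulmx1 addr0.
- move=> E /ellipsoid_upper_triangular[T [b [upT T0 ->]]] sub.
  rewrite volume_ellipsoid//; last exact: upper_triangular_unit.
  rewrite -[leRHS]mul1e lee_pmul2r// lee_fin.
  exact: (prod_diag_le1 f_lc ball_sub contact c0 identity centered upT T0 sub).
move=> E [/ellipsoid_upper_triangular[T [b [upT T0 ->]]] sub maxE].
(* The ball competes with [E], which gives the reverse bound on the diagonal product and hence the
   equality case. *)
have := maxE B; rewrite volume_ellipsoid//; last exact: upper_triangular_unit.
move=> /(_ _ ball_sub) h.
have prod_ge1 : 1 <= \prod_i T i i.
  rewrite -lee_fin -(lee_pmul2r volBfin volB) mul1e; apply: h.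
  exists 1%:M, 0; split; first exact: unitmx1.
  apply/seteqP; split=> [x Bx|_ [x Bx <-]]; last by rewrite mulmx1 addr0.
  by exists x => //; rewrite mulmx1 addr0.
have prod1 : \prod_i T i i = 1.
  apply/eqP; rewrite eq_le prod_ge1 andbT.
  exact: (prod_diag_le1 f_lc ball_sub contact c0 identity centered upT T0 sub).
have [-> ->] := prod_diag_eq1_unit_ball f_lc ball_sub contact c0 identity centered upT T0 sub prod1.
apply/seteqP; split=> [_ [x Bx <-]|x Bx]; first by rewrite mulmx1 addr0.
by exists x => //; rewrite mulmx1 addr0.
Qed.
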